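(* Let $(M^n,g)$ be an $n$-dimensional compact Riemannian manifold with nonempty smooth boundary $\partial M$ and $Ric>0$, and let $k=\inf_{p\in M}\lambda_{\min}(Ric)(p)$. Then the following statements hold: (1) If the mean curvature of the boundary satisfies $H\ge0$, then $\lambda_{1,D}>k$. (2) If $\partial M$ is convex, that is, the second fundamental form of $\partial M$ is non-negative, then $\lambda_{1,N}>k$.
   Context: $\lambda_{\min}(Ric)(p)$ is the smallest eigenvalue (with respect to $g$) of the Ricci tensor at $p$. $\lambda_{1,D}$ is the first eigenvalue of the Dirichlet problem $\triangle f=-\lambda f$ in $M$, $f=0$ on $\partial M$; $\lambda_{1,N}$ is the first nonzero (smallest positive) eigenvalue of the Neumann problem $\triangle f=-\lambda f$ in $M$, $\partial f/\partial\eta=0$ on $\partial M$. Here $\triangle$ is the Laplacian of $g$ and $\eta$ is the outward unit normal along $\partial M$; the second fundamental form of $\partial M$ is $(X,Y)\mapsto\langle\nabla_X\eta,Y\rangle$ for $X,Y$ tangent to $\partial M$, and the mean curvature $H$ is its trace.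
   Formalization: The manifold M is additionally assumed connected; without this, statement (1) fails if M has a component without boundary, where constants give the Dirichlet eigenvalue 0. *)

(* Defs.v *)
From HB Require Import structures.
From mathcomp Require Import all_boot all_order all_algebra.
From mathcomp Require Import all_classical all_reals all_analysis.

Set Implicit Arguments.
Unset Strict Implicit.
Unset Printing Implicit Defensive.

Import Order.TTheory GRing.Theory Num.Theory.
Import numFieldNormedType.Exports.

Local Open Scope classical_set_scope.
Local Open Scope ring_scope.

Section HalfSpace.
Context {R : realType} {n : nat}.
Local Notation E := 'rV[R]_n.+1.

Definition half_space : set E := [set x | 0 <= x 0 ord0].

(* All the difference quotients stay inside the half space: where [x 0 ord0 = 0]
   the partial derivative in the direction [ord0] is the one-sided one, and
   everywhere else in the half space [partial] is the usual partial derivative.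
   The values of [f] outside the half space are irrelevant, so that partial
   derivatives can be iterated up to the boundary. *)
Definition partial (i : 'I_n.+1) (f : E -> R) (x : E) : R :=
  lim ((fun h : R => h^-1 * (f (x + h *: delta_mx 0 i) - f x))
         @ within [set h : R | half_space (x + h *: delta_mx 0 i)] 0^').

Fixpoint Ck (V : normedModType R) (k : nat) (W : set E) (f : E -> V) : Prop :=
  match k with
  | 0 => forall x, W x -> {for x, continuous f}
  | k'.+1 => (forall x, W x -> differentiable f x) /\
             (forall v : E, Ck k' W ('D_v f))
  end.

(* Smoothness on a set which need not be open: local smooth extendability. *)
Definition smooth_on (V : normedModType R) (U : set E) (f : E -> V) : Prop :=
  forall x, U x -> exists (W : set E) (F : E -> V),
    [/\ open W, W x, forall k, Ck k W F & forall y, W y -> U y -> F y = f y].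

End HalfSpace.

(* A homeomorphism from an open subset of [M] onto a relatively open subset of
   the half space. *)
Record chart (R : realType) (n : nat) (M : topologicalType) := Chart {
  chart_dom : set M;
  chart_map : M -> 'rV[R]_n.+1;
  chart_inv : 'rV[R]_n.+1 -> M;
  chart_dom_open : open chart_dom;
  chart_image_open : exists2 O : set 'rV[R]_n.+1,
    open O & chart_map @` chart_dom = O `&` half_space;
  chart_mapK : {in chart_dom, cancel chart_map chart_inv};
  chart_map_continuous : {within chart_dom, continuous chart_map};
  chart_inv_continuous :
    {within chart_map @` chart_dom, continuous chart_inv} }.

Definition chart_image {R : realType} {n : nat} {M : topologicalType}
  (c : chart R n M) : set 'rV[R]_n.+1 := chart_map c @` chart_dom c.

(* Dimension [n.+1]: a manifold of dimension 0 has no boundary. *)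
Record manifold (R : realType) (n : nat) (M : topologicalType) := Manifold {
  atlas : set (chart R n M);
  manifold_hausdorff : hausdorff_space M;
  manifold_second_countable : @second_countable M;
  atlas_cover : forall p : M, exists2 c, atlas c & chart_dom c p;
  atlas_smooth : forall c d, atlas c -> atlas d ->
    smooth_on (chart_map c @` (chart_dom c `&` chart_dom d))
              (chart_map d \o chart_inv c) }.

Section Boundary.
Context {R : realType} {n : nat} {M : topologicalType}.
Local Notation E := 'rV[R]_n.+1.

(* [x] is the coordinate vector, in the chart [c], of a boundary point. *)
Definition chart_boundary (c : chart R n M) : set E :=
  [set x | chart_image c x /\ x 0 ord0 = 0].

Definition manifold_boundary (A : manifold R n M) : set M :=
  [set p | exists c, [/\ atlas A c, chart_dom c p & chart_map c p 0 ord0 = 0]].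

Definition jacobian_transition (c d : chart R n M) (x : E) : 'M[R]_n.+1 :=
  \matrix_(i, a) partial i (fun y => chart_map d (chart_inv c y) 0 a) x.

Definition smooth_function (A : manifold R n M) (f : M -> R) : Prop :=
  forall c, atlas A c ->
    smooth_on (chart_image c) (f \o chart_inv c : E -> R^o).

End Boundary.

(* [gram c x] is the matrix of the metric in the coordinate frame of the chart
   [c] at the point with coordinates [x]. Tangent vectors are row vectors, and a
   vector [v] in the chart [c] is [v *m jacobian_transition c d x] in [d]. *)
Record metric (R : realType) (n : nat) (M : topologicalType)
    (A : manifold R n M) := Metric {
  gram :> chart R n M -> 'rV[R]_n.+1 -> 'M[R]_n.+1;
  gram_sym : forall c x, atlas A c -> chart_image c x ->
    (gram c x)^T = gram c x;
  gram_posdef : forall c x (v : 'rV[R]_n.+1), atlas A c -> chart_image c x ->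
    v != 0 -> 0 < (v *m gram c x *m v^T) 0 0;
  gram_smooth : forall c i j, atlas A c ->
    smooth_on (chart_image c) ((fun x => gram c x i j) : 'rV[R]_n.+1 -> R^o);
  gram_transition : forall c d p, atlas A c -> atlas A d ->
    chart_dom c p -> chart_dom d p ->
    gram c (chart_map c p) =
      jacobian_transition c d (chart_map c p) *m gram d (chart_map d p)
        *m (jacobian_transition c d (chart_map c p))^T }.

(* All the tensors below are given by their components in the coordinate frame
   of a chart [c], as functions of the coordinate vector. *)
Section Geometry.
Context {R : realType} {n : nat} {M : topologicalType} {A : manifold R n M}.
Variable g : metric A.
Local Notation E := 'rV[R]_n.+1.

Implicit Types (c : chart R n M) (i j k l m : 'I_n.+1).

Definition cometric c (x : E) : 'M[R]_n.+1 := invmx (g c x).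

(* nabla_(d_i) d_j = \sum_k christoffel c k i j * d_k *)
Definition christoffel c k i j (x : E) : R :=
  2^-1 * \sum_l cometric c x k l *
    (partial i (fun y => g c y j l) x + partial j (fun y => g c y i l) x
     - partial l (fun y => g c y i j) x).

(* R(d_i, d_j) d_k = \sum_l riemann c l k i j * d_l,
   where R(X, Y) = [nabla_X, nabla_Y] - nabla_[X, Y] *)
Definition riemann c l k i j (x : E) : R :=
  partial i (christoffel c l j k) x - partial j (christoffel c l i k) x
  + \sum_m (christoffel c m j k x * christoffel c l i m x
            - christoffel c m i k x * christoffel c l j m x).

(* Ric(Y, Z) is the trace of X |-> R(X, Y) Z, positive on round spheres. *)
Definition ricci c (x : E) : 'M[R]_n.+1 :=
  \matrix_(j, k) \sum_i riemann c i k i j x.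

Definition ricci_positive : Prop :=
  forall c (x v : E), atlas A c -> chart_image c x -> v != 0 ->
    0 < (v *m ricci c x *m v^T) 0 0.

(* The eigenvalues with respect to [g] are the [mu] such that
   [v *m ricci c x = mu *: (v *m g c x)] for some [v != 0]. They are finitely
   many and, by symmetry, there is at least one: the infimum is a minimum. *)
Definition ricci_min c (x : E) : R :=
  inf [set mu | eigenvalue (ricci c x *m cometric c x) mu].

(* [ricci_min c (chart_map c p)] does not depend on the chart [c] around [p]. *)
Definition ricci_lower_bound : R :=
  inf [set r | exists c (p : M),
         [/\ atlas A c, chart_dom c p & r = ricci_min c (chart_map c p)]].

(* trace of the Hessian *)
Definition laplacian c (f : M -> R) (x : E) : R :=
  \sum_i \sum_j cometric c x i j *
    (partial i (partial j (f \o chart_inv c)) x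
     - \sum_k christoffel c k i j x * partial k (f \o chart_inv c) x).

(* At a boundary point, the vector proportional to the gradient of the
   coordinate [ord0], normalized and pointing out of the half space; see
   [outward_normalP]. *)
Definition outward_normal c (x : E) : E :=
  - (Num.sqrt (cometric c x ord0 ord0))^-1 *: row ord0 (cometric c x).

(* The row [i] is nabla_(d_i) eta. It is used only in directions tangent to the
   boundary, for which it depends only on the values of eta on the boundary. *)
Definition nabla_normal c (x : E) : 'M[R]_n.+1 :=
  \matrix_(i, k) (partial i (fun y => outward_normal c y 0 k) x
    + \sum_j christoffel c k i j x * outward_normal c x 0 j).

Definition second_form c (x : E) (X Y : E) : R :=
  (X *m nabla_normal c x *m g c x *m Y^T) 0 0.

(* The vectors d_(lift ord0 a), for [a : 'I_n], are a frame of the boundary. *)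
Definition induced_gram c (x : E) : 'M[R]_n :=
  \matrix_(a, b) g c x (lift ord0 a) (lift ord0 b).

Definition second_form_mx c (x : E) : 'M[R]_n :=
  \matrix_(a, b) second_form c x (delta_mx 0 (lift ord0 a))
                                 (delta_mx 0 (lift ord0 b)).

(* trace with respect to the induced metric *)
Definition mean_curvature c (x : E) : R :=
  \tr (second_form_mx c x *m invmx (induced_gram c x)).

Definition mean_convex_boundary : Prop :=
  forall c (x : E), atlas A c -> chart_boundary c x -> 0 <= mean_curvature c x.

Definition convex_boundary : Prop :=
  forall c (x X : E), atlas A c -> chart_boundary c x -> X 0 ord0 = 0 ->
    0 <= second_form c x X X.

Definition normal_derivative c (f : M -> R) (x : E) : R :=
  \sum_k outward_normal c x 0 k * partial k (f \o chart_inv c) x.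

Definition eigenfunction (lambda : R) (f : M -> R) : Prop :=
  [/\ smooth_function A f, exists p, f p != 0 &
      forall c p, atlas A c -> chart_dom c p ->
        laplacian c f (chart_map c p) = - lambda * f p].

Definition dirichlet_eigenvalue (lambda : R) : Prop :=
  exists2 f, eigenfunction lambda f &
    forall p, manifold_boundary A p -> f p = 0.

Definition neumann_eigenvalue (lambda : R) : Prop :=
  exists2 f, eigenfunction lambda f &
    forall c x, atlas A c -> chart_boundary c x -> normal_derivative c f x = 0.

Definition first_dirichlet_eigenvalue (lambda : R) : Prop :=
  dirichlet_eigenvalue lambda /\
  forall mu, dirichlet_eigenvalue mu -> lambda <= mu.

Definition first_neumann_eigenvalue (lambda : R) : Prop :=
  [/\ neumann_eigenvalue lambda, 0 < lambda &
      forall mu, neumann_eigenvalue mu -> 0 < mu -> lambda <= mu].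

Lemma outward_normalP c (x : E) : atlas A c -> chart_boundary c x ->
  [/\ (outward_normal c x *m g c x *m (outward_normal c x)^T) 0 0 = 1,
      forall X : E, X 0 ord0 = 0 ->
        (outward_normal c x *m g c x *m X^T) 0 0 = 0 &
      outward_normal c x 0 ord0 < 0].
Proof.
move=> Ac [cx _].
have gU : g c x \in unitmx.
  rewrite -row_free_unit -kermx_eq0; apply/rowV0P => v /sub_kermxP vg.
  apply/eqP; apply: contraT => /(gram_posdef g Ac cx).
  by rewrite vg mul0mx mxE ltxx.
have e0 : row ord0 (cometric c x) *m g c x = delta_mx 0 ord0.
  by rewrite rowE -mulmxA mulVmx// mulmx1.
have ip (Y : E) : (row ord0 (cometric c x) *m g c x *m Y^T) 0 0 = Y 0 ord0.
  by rewrite e0 -rowE !mxE.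
have pos : 0 < cometric c x ord0 ord0.
  have := @gram_posdef _ _ _ _ g c x (row ord0 (cometric c x)) Ac cx.
  rewrite ip mxE; apply; apply/eqP => r0; move: e0.
  rewrite r0 mul0mx => /matrixP /(_ 0 ord0).
  by rewrite !mxE !eqxx => /eqP; rewrite eq_sym oner_eq0.
have sq : 0 < Num.sqrt (cometric c x ord0 ord0) by rewrite sqrtr_gt0.
have ipn (Y : E) : (outward_normal c x *m g c x *m Y^T) 0 0
    = - (Num.sqrt (cometric c x ord0 ord0))^-1 * Y 0 ord0.
  by rewrite /outward_normal -!scalemxAl mxE ip.
split=> [|X X0|].
- rewrite ipn !mxE mulrA mulrNN -invfM -expr2 sqr_sqrtr ?ltW//.
  by rewrite mulVf ?gt_eqF.
- by rewrite ipn X0 mulr0.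
- by rewrite !mxE mulNr oppr_lt0 mulr_gt0 ?invr_gt0.
Qed.

End Geometry.

(* Main.v *)
Require Import Defs.
From HB Require Import structures.
From mathcomp Require Import all_boot all_order all_algebra.
From mathcomp Require Import ring.
From mathcomp Require Import all_classical all_reals all_analysis.

(** Let [lam] be the eigenvalue of an eigenfunction [f] and suppose that it is at
    most the lower bound [k] of the Ricci curvature. The maximum principle for

      F = |grad f|^2 + a f^2,   with a constant a >= 0,

    rules this out pointwise, without integration. Let [p] be a maximum of [F] on
    the compact manifold, and [N] its dimension.

    - The Laplacian of [F] is nonpositive at [p]. Inside the manifold this is
      clear. If [p] lies on the boundary, the tangential derivatives of [F] vanish
      and the outward normal derivative is nonnegative. The latter is also
      nonpositive ([neumann_boundary], [dirichlet_boundary]): with [eta] the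
      normal, the derivative of |grad f|^2 is 2 Hess f (eta, grad f), which is
      -2 II (grad f, grad f) under the Neumann condition and - 2 (eta f)^2 H under
      the Dirichlet condition, while that of f^2 is zero in both cases. So the
      differential of [F] vanishes at [p], and then the inequality
      F (p + h v) <= F p for inward [v] makes the second derivative of [F]
      nonpositive along [v], hence along [- v] ([max_hessian_le0]).

    - By Bochner's formula ([bochner]) half the Laplacian of [F] is

        |Hess f|^2 + Ric (grad f, grad f) - lam |grad f|^2
          + a |grad f|^2 - a lam f^2,

      and |Hess f|^2 >= (Delta f)^2 / N = lam^2 f^2 / N ([trace_sqr_le]). The
      resulting inequality at [p] is [max_inequality].

    If [lam] is not zero, then for a = |lam| / (2 N) the coefficients of f^2 and of
    |grad f|^2 are positive, since Ric >= k g >= lam g. So [F] vanishes at its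
    maximum and f = 0, a contradiction ([eigenvalue_eq0]). The eigenvalue zero
    concerns only the Dirichlet problem. There a = 0 and Ric > 0 show that the
    gradient vanishes where it is largest, so [f] is constant by connectedness, and
    its boundary value is zero ([zero_eigenvalue_critical],
    [constant_of_critical]).

    Bochner's formula and the boundary identities are proved in an arbitrary
    commutative ring with commuting derivations. They apply to the functions that
    are smooth on a chart image up to the boundary: with the one-sided partial
    derivatives these form such a ring, by the symmetry of second derivatives
    ([Schwarz]). *)

Set Implicit Arguments.
Unset Strict Implicit.
Unset Printing Implicit Defensive.

Import Order.TTheory GRing.Theory Num.Theory.
Import numFieldNormedType.Exports.

Local Open Scope classical_set_scope.
Local Open Scope ring_scope.

(** * Riemannian geometry in a differential ring *)

Section MatrixAux.
Variables (S : pzRingType).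
Lemma trmxD m p (A B : 'M[S]_(m, p)) : (A + B)^T = A^T + B^T.
Proof. by apply/matrixP => i j; rewrite !mxE. Qed.
Lemma trmxN m p (A : 'M[S]_(m, p)) : (- A)^T = - A^T.
Proof. by apply/matrixP => i j; rewrite !mxE. Qed.
Lemma trmx_scalar11 (A : 'M[S]_1) : A^T = A.
Proof. by apply/matrixP => i j; rewrite !ord1 mxE. Qed.
Lemma row_coordE m p (A : 'M[S]_(m, p)) i j : row i A 0 j = A i j.
Proof. by rewrite mxE. Qed.
Lemma mulmx_coordE m p q (A : 'M[S]_(m, p)) (B : 'M[S]_(p, q)) i j :
  (A *m B) i j = \sum_k A i k * B k j.
Proof. by rewrite mxE. Qed.
Lemma addmx_coordE m p (A B : 'M[S]_(m, p)) i j : (A + B) i j = A i j + B i j.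
Proof. by rewrite mxE. Qed.
Lemma subrmx_coordE m p (A B : 'M[S]_(m, p)) i j : (A - B) i j = A i j - B i j.
Proof. by rewrite !mxE. Qed.
Lemma oppmx_coordE m p (A : 'M[S]_(m, p)) i j : (- A) i j = - A i j.
Proof. by rewrite mxE. Qed.
Lemma mxtraceN p (A : 'M[S]_p) : \tr (- A) = - \tr A.
Proof. exact: raddfN. Qed.
End MatrixAux.

Section DifferentialRing.
Variables (S : comPzRingType) (n : nat).
Local Notation N := n.+1.
Variable D : 'I_N -> {additive S -> S}.
Hypothesis DM : forall i a b, D i (a * b) = D i a * b + a * D i b.
Hypothesis DC : forall i j a, D i (D j a) = D j (D i a).
Variable half : S.
Hypothesis half2 : half + half = 1.

Lemma map_mx_derM i m p q (A : 'M[S]_(m, p)) (B : 'M[S]_(p, q)) :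
  map_mx (D i) (A *m B) = map_mx (D i) A *m B + A *m map_mx (D i) B.
Proof.
apply/matrixP => a b; rewrite !mxE raddf_sum -big_split /=.
by apply: eq_bigr => k _; rewrite DM !mxE.
Qed.

Lemma D_one i : D i 1 = 0.
Proof.
by have := DM i 1 1; rewrite !mulr1 mul1r => /esym/eqP;
  rewrite -subr_eq0 addrK => /eqP.
Qed.

Lemma map_mx_der1 i : map_mx (D i) 1%:M = 0 :> 'M[S]_N.
Proof. by apply/matrixP => a b; rewrite !mxE; case: eqP; rewrite ?D_one ?raddf0. Qed.

Lemma D_half i : D i half = 0.
Proof.
have h : D i half + D i half = 0 by rewrite -raddfD half2 D_one.
by rewrite -[D i half]mul1r -half2 mulrDl -mulrDr h mulr0.
Qed.

Variables G H : 'M[S]_N.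
Hypothesis GT : G^T = G.
Hypothesis HG : H *m G = 1%:M.

Lemma mulmxGH : G *m H = 1%:M. Proof. exact: mulmx1C. Qed.

Lemma inv_metric_tr : H^T = H.
Proof. by rewrite -[LHS]mulmx1 -mulmxGH mulmxA -{1}GT -trmx_mul mulmxGH trmx1 mul1mx. Qed.

(** [half] stands for 1/2 and [H] for the inverse of the metric matrix [G]. *)
Definition christ k i j : S :=
  half * \sum_l H k l * (D i (G j l) + D j (G i l) - D l (G i j)).

(** For a vector field with the row [X] of components, [D i X + X *m conn i] is its
    covariant derivative in the direction [i]. *)
Definition conn i : 'M[S]_N := \matrix_(j, k) christ k i j.

(** Christoffel symbols of the first kind. *)
Definition christ1 i : 'M[S]_N :=
  \matrix_(j, l) (half * (D i (G j l) + D j (G i l) - D l (G i j))).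

Lemma metric_symE i j : G i j = G j i. Proof. by rewrite -{1}GT mxE. Qed.
Lemma inv_metric_symE i j : H i j = H j i. Proof. by rewrite -{1}inv_metric_tr mxE. Qed.

Lemma christC k i j : christ k i j = christ k j i.
Proof.
rewrite /christ; congr (_ * _); apply: eq_bigr => l _; congr (_ * _).
by rewrite (metric_symE i j) (addrC (D i _)).
Qed.

Lemma conn_christ1 i : conn i = christ1 i *m H.
Proof.
apply/matrixP => j k; rewrite !mxE /christ mulr_sumr; apply: eq_bigr => l _.
by rewrite !mxE (inv_metric_symE k) mulrCA mulrC.
Qed.

Lemma conn_metric i : conn i *m G = christ1 i.
Proof. by rewrite conn_christ1 -mulmxA HG mulmx1. Qed.

(** In the sum of the symbols of the first kind and their transpose all
    derivatives of the metric cancel but one. *)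
Lemma metric_compat i : map_mx (D i) G = conn i *m G + G *m (conn i)^T.
Proof.
rewrite -[in X in _ + X]GT -trmx_mul conn_metric; apply/matrixP => j l; rewrite !mxE.
rewrite (metric_symE l j) -[LHS]mul1r -half2; ring.
Qed.

(** Differentiate [H *m G = 1%:M]. *)
Lemma cometric_compat i : map_mx (D i) H = - (H *m conn i + (conn i)^T *m H).
Proof.
have : map_mx (D i) (H *m G) *m H = 0 by rewrite HG map_mx_der1 mul0mx.
rewrite map_mx_derM mulmxDl -mulmxA mulmxGH mulmx1 => /eqP; rewrite addr_eq0 => /eqP ->.
congr (- _); rewrite metric_compat mulmxDr mulmxDl -!mulmxA mulmxGH mulmx1.
by rewrite (mulmxA H G) HG mul1mx.
Qed.

(** Components are row vectors, on which matrices act from the right; whence the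
    order of the two products. *)
Definition curv i j : 'M[S]_N :=
  map_mx (D i) (conn j) - map_mx (D j) (conn i)
  + (conn j *m conn i - conn i *m conn j).

Lemma map_mxDC i j m p (A : 'M[S]_(m, p)) :
  map_mx (D i) (map_mx (D j) A) = map_mx (D j) (map_mx (D i) A).
Proof. by apply/matrixP => a b; rewrite !mxE DC. Qed.

(** Two derivatives of [G] commute. Expressed by [metric_compat], their commutator is
    the symmetric part of [curv i j *m G]. *)
Lemma curv_antisym i j : (curv i j *m G)^T = - (curv i j *m G).
Proof.
have DDG a b : map_mx (D a) (map_mx (D b) G) =
    (map_mx (D a) (conn b) *m G + conn b *m (conn a *m G)
      + (map_mx (D a) (conn b) *m G + conn b *m (conn a *m G))^T)
    + (conn b *m G *m (conn a)^T + conn a *m G *m (conn b)^T).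
  rewrite metric_compat map_mxD !map_mx_derM -map_trmx metric_compat.
  rewrite !trmxD !trmx_mul GT !mulmxDr !mulmxDl !mulmxA.
  by rewrite [LHS](AC ((1*2)*3) ((1*2)*(6*5)*(3*4))).
have := map_mxDC i j G; rewrite !DDG => /eqP; rewrite -subr_eq0.
rewrite opprD addrACA (addrC (conn j *m G *m _)) subrr addr0 => /eqP h.
apply/eqP; rewrite -addr_eq0 -[X in _ == X]h; apply/eqP.
rewrite /curv !mulmxDl !mulNmx -!mulmxA !trmxD !trmxN.
set a := map_mx _ (conn j) *m G; set b := map_mx _ (conn i) *m G.
set c := conn j *m _; set d := conn i *m _.
by apply/matrixP => x y; rewrite !mxE; ring.
Qed.

Definition ric : 'M[S]_N := \matrix_(j, k) \sum_i curv i j k i.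

Lemma mxtrace_der i (A : 'M[S]_N) : D i (\tr A) = \tr (map_mx (D i) A).
Proof. by rewrite raddf_sum; apply: eq_bigr => k _; rewrite mxE. Qed.

(** The trace of [conn j] is half the trace of [D j G *m H], the logarithmic
    derivative of the volume density. Its derivative is symmetric since that of [H] is
    [- (H *m D i G *m H)] and the trace is cyclic. *)
Lemma trace_conn_derC i j : D i (\tr (conn j)) = D j (\tr (conn i)).
Proof.
have trE k : \tr (conn k) = half * \tr (map_mx (D k) G *m H).
  have -> : map_mx (D k) G = christ1 k + (christ1 k)^T.
    by rewrite -conn_metric trmx_mul GT metric_compat.
  rewrite mulmxDl mxtraceD -[in X in _ + X]inv_metric_tr -trmx_mul mxtrace_tr.
  rewrite (mxtrace_mulC H) -mulr2n -mulr_natl mulrA [half * _]mulrDr !mulr1.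
  by rewrite half2 mul1r -conn_christ1.
have DHE k : map_mx (D k) H = - (H *m map_mx (D k) G *m H).
  rewrite cometric_compat metric_compat mulmxDr mulmxDl -!mulmxA mulmxGH mulmx1.
  by rewrite (mulmxA H G) HG mul1mx.
rewrite !trE !DM !D_half !mul0r !add0r; congr (_ * _).
rewrite !mxtrace_der !map_mx_derM !mxtraceD map_mxDC; congr (_ + _).
rewrite !DHE !mulmxN !mxtraceN; congr (- _).
by rewrite !mulmxA -mulmxA mxtrace_mulC !mulmxA.
Qed.

(** The only term that is not visibly symmetric is the derivative of the contracted
    Christoffel symbols. *)
Lemma ric_sym : ric^T = ric.
Proof.
suff ricE j k : ric j k =
    \sum_i D i (christ i j k) - D j (\tr (conn k))
    + (\sum_i \sum_m christ m j k * christ i i m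
       - \sum_i \sum_m christ m i k * christ i j m).
  apply/matrixP => j k; rewrite mxE !ricE trace_conn_derC; congr (_ - _ + (_ - _)).
  - by apply: eq_bigr => i _; rewrite christC.
  - by apply: eq_bigr => i _; apply: eq_bigr => m _; rewrite christC.
  rewrite exchange_big; apply: eq_bigr => i _; apply: eq_bigr => m _ /=.
  by rewrite mulrC (christC i) (christC m).
rewrite mxE -!sumrB raddf_sum -!sumrB -big_split; apply: eq_bigr => i _ /=.
rewrite !mxE (christC _ i k); congr (_ + (_ - _)).
  by apply: eq_bigr => m _; rewrite !mxE.
by apply: eq_bigr => m _; rewrite !mxE.
Qed.

Definition lap (f : S) : S :=
  \sum_i \sum_j H i j * (D i (D j f) - \sum_k christ k i j * D k f).

Definition du (u : S) : 'rV[S]_N := \row_k D k u.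
Definition hess (u : S) : 'M[S]_N :=
  \matrix_(i, j) (D i (D j u) - \sum_k christ k i j * D k u).
Definition grad u : 'cV[S]_N := H *m (du u)^T.
Definition gradsq u : S := (du u *m grad u) 0 0.

Lemma hessE u i j : hess u i j = D i (D j u) - \sum_k christ k i j * D k u.
Proof. by rewrite mxE. Qed.

Lemma hess_sym u : (hess u)^T = hess u.
Proof.
apply/matrixP => i j; rewrite !mxE DC; congr (_ - _).
by apply: eq_bigr => k _; rewrite christC.
Qed.

Lemma lapE u : lap u = \tr (H *m hess u).
Proof.
rewrite /mxtrace; apply: eq_bigr => i _; rewrite !mxE; apply: eq_bigr => j _.
by rewrite -[in RHS]hess_sym !mxE.
Qed.

Lemma row_hess u i : row i (hess u) = map_mx (D i) (du u) - du u *m (conn i)^T.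
Proof.
apply/rowP => j; rewrite !mxE; congr (_ - _); apply: eq_bigr => k _.
by rewrite !mxE mulrC.
Qed.

Lemma D_du u i : map_mx (D i) (du u) = row i (hess u) + du u *m (conn i)^T.
Proof. by rewrite row_hess subrK. Qed.

Definition nabla_hess u i : 'M[S]_N :=
  map_mx (D i) (hess u) - conn i *m hess u - hess u *m (conn i)^T.

Lemma nabla_hess_sym u i : (nabla_hess u i)^T = nabla_hess u i.
Proof.
rewrite /nabla_hess !trmxD !trmxN !trmx_mul trmxK hess_sym map_trmx hess_sym.
by rewrite -!addrA [X in _ + X]addrC.
Qed.

Lemma nabla_hess_symE u i j k : nabla_hess u i j k = nabla_hess u i k j.
Proof. by rewrite -{1}nabla_hess_sym mxE. Qed.

Lemma D_hess u i : map_mx (D i) (hess u) =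
  nabla_hess u i + conn i *m hess u + hess u *m (conn i)^T.
Proof. by rewrite /nabla_hess -addrA (addrC (_ *m _)) addrA !subrK. Qed.

(** As the metric is parallel, the trace of the covariant derivative of the Hessian
    is the derivative of its trace. *)
Lemma D_lap u i : D i (lap u) = \tr (H *m nabla_hess u i).
Proof.
rewrite lapE mxtrace_der map_mx_derM cometric_compat D_hess !mulmxDr.
rewrite mulNmx mulmxDl !mxtraceD mxtraceN mxtraceD.
rewrite -(mulmxA _ H) (mxtrace_mulC (_^T)) -!mulmxA.
ring.
Qed.

(** The Ricci identity for the one-form [du u]: the terms with two or more derivatives
    of [u] are symmetric in [i] and [j], the others make up the curvature. *)
Lemma ricci_identity_row u i j :
  row j (nabla_hess u i) - row i (nabla_hess u j) = - (du u *m (curv i j)^T).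
Proof.
have E a b : row b (nabla_hess u a) =
    map_mx (D a) (map_mx (D b) (du u)) - du u *m (map_mx (D a) (conn b))^T
    - row b (conn a *m hess u)
    - (map_mx (D a) (du u) *m (conn b)^T + map_mx (D b) (du u) *m (conn a)^T)
    + du u *m (conn a *m conn b)^T.
  rewrite /nabla_hess !raddfB /= -[row b (map_mx _ _)]map_row row_mul row_hess.
  rewrite map_mxB map_mx_derM -map_trmx trmx_mul !row_mul row_hess mulmxBl mulmxA.
  by apply/rowP => k; rewrite !mxE; ring.
have rC : row i (conn j *m hess u) = row j (conn i *m hess u).
  by apply/rowP => k; rewrite !mxE; apply: eq_bigr => l _; rewrite !mxE christC.
rewrite !E rC map_mxDC /curv !trmxD !trmxN !mulmxDr !mulmxN.
by apply/rowP => k; rewrite !mxE; ring.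
Qed.

Lemma ricci_identity u i j m :
  nabla_hess u i j m - nabla_hess u j i m = - (curv i j *m (du u)^T) m 0.
Proof.
have /rowP/(_ m) := ricci_identity_row u i j.
rewrite subrmx_coordE !row_coordE oppmx_coordE => ->; congr (- _).
by rewrite -[du u *m _]trmxK trmx_mul trmxK mxE.
Qed.

Lemma D_grad u i :
  map_mx (D i) (grad u) = H *m (row i (hess u))^T - (conn i)^T *m grad u.
Proof.
rewrite /grad map_mx_derM -map_trmx cometric_compat D_du trmxD trmx_mul trmxK.
rewrite mulmxDr mulNmx mulmxDl opprD !mulmxA [H *m _ + _]addrC.
by rewrite addrACA addNr add0r addrC.
Qed.

Lemma gradP u : (grad u)^T *m G = du u.
Proof. by rewrite /grad trmx_mul trmxK inv_metric_tr -mulmxA HG mulmx1. Qed.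

Lemma D_gradsq u i : D i (gradsq u) = 2 * (hess u *m grad u) i 0.
Proof.
have -> : D i (gradsq u) = (map_mx (D i) (du u *m grad u)) 0 0 by rewrite mxE.
have rE : (row i (hess u) *m grad u) 0 0 = (hess u *m grad u) i 0.
  by rewrite -row_mul mxE.
rewrite map_mx_derM D_grad D_du mulmxDl mulmxBr -(mulmxA (du u) _ (grad u)).
rewrite addrACA subrr addr0.
have -> : du u *m (H *m (row i (hess u))^T) = row i (hess u) *m grad u.
  by rewrite -[LHS]trmx_scalar11 !trmx_mul trmxK inv_metric_tr mulmxA.
by rewrite mxE rE mulr_natl mulr2n.
Qed.

Lemma D_hess_grad u i : map_mx (D i) (hess u *m grad u) =
  nabla_hess u i *m grad u + conn i *m (hess u *m grad u)
  + hess u *m H *m (row i (hess u))^T.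
Proof.
rewrite map_mx_derM D_grad D_hess !mulmxDl mulmxBr -!(mulmxA _ _ (grad u)).
by rewrite addrACA subrr addr0 (mulmxA _ H (row i (hess u))^T).
Qed.

(** Bochner's formula. The third derivatives of [u] enter through
    [nabla_hess u i j p], contracted over [i] and [j]. Exchanging [i] and [p] by the
    Ricci identity turns them into derivatives of the Laplacian; the antisymmetry of
    the curvature identifies the remainder with the Ricci tensor. The last trace is
    the squared norm of the Hessian. *)
Lemma bochner u : lap (gradsq u) =
  2 * ((du (lap u) *m grad u) 0 0 + ((grad u)^T *m ric *m grad u) 0 0
       + \tr (H *m hess u *m (H *m hess u))).
Proof.
pose w := hess u *m grad u.
have step i j : D i (D j (gradsq u)) - \sum_k christ k i j * D k (gradsq u) =
    2 * ((nabla_hess u i *m grad u) j 0 + (hess u *m H *m hess u) j i).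
  have D2 : D i 2 = 0 by rewrite raddfMn D_one mul0rn.
  rewrite D_gradsq DM D2 mul0r add0r.
  have -> : \sum_k christ k i j * D k (gradsq u) = 2 * (conn i *m w) j 0.
    rewrite mxE mulr_sumr; apply: eq_bigr => k _.
    by rewrite D_gradsq [conn _ _ _]mxE mulrCA.
  rewrite -mulrBr; congr (_ * _).
  have /matrixP/(_ j 0) := D_hess_grad u i; rewrite mxE -/w => ->.
  rewrite tr_row hess_sym colE mulmxA -colE mxE [X in X + _ - _]mxE [col _ _ _ _]mxE.
  by rewrite addrAC addrK.
rewrite /lap; under eq_bigr => i _ do under eq_bigr => j _ do rewrite step mulrCA.
under eq_bigr => i _ do rewrite -mulr_sumr.
rewrite -mulr_sumr; congr (_ * _).
under eq_bigr => i _ do under eq_bigr => j _ do rewrite mulrDr.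
under eq_bigr => i _ do rewrite big_split.
rewrite big_split /=; congr (_ + _); last first.
  rewrite /mxtrace; apply: eq_bigr => i _; rewrite -[in RHS]mulmxA mxE.
  by apply: eq_bigr => j _; rewrite mulmxA.
(* It remains to exchange [i] and [p] in the contracted third derivatives. *)
transitivity (\sum_p (\sum_i \sum_j H i j * nabla_hess u i j p) * grad u p 0).
  under [RHS]eq_bigr => p _.
    rewrite mulr_suml; under eq_bigr => i _ do rewrite mulr_suml.
    over.
  rewrite [RHS]exchange_big /=; apply: eq_bigr => i _.
  rewrite exchange_big /=; apply: eq_bigr => j _.
  by rewrite mxE mulr_sumr; apply: eq_bigr => p _; rewrite mulrA.
rewrite (mulmx_coordE (du _)) (mulmx_coordE (_ *m ric)) -big_split /=.
apply: eq_bigr => p _; rewrite -mulrDl; congr (_ * _).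
have -> : (du (lap u)) 0 p = \sum_i \sum_j H i j * nabla_hess u p i j.
  rewrite mxE D_lap; apply: eq_bigr => i _; rewrite !mxE; apply: eq_bigr => j _.
  by rewrite nabla_hess_symE.
rewrite mulmx_coordE -[LHS](subrK (\sum_i \sum_j H i j * nabla_hess u p i j)) addrC; congr (_ + _).
transitivity (- \sum_i \sum_j H i j * (curv i p *m (du u)^T) j 0).
  rewrite -sumrB -sumrN; apply: eq_bigr => i _.
  rewrite -sumrB -sumrN; apply: eq_bigr => j _.
  rewrite -mulrBr -mulrN; congr (_ * _).
  by rewrite nabla_hess_symE ricci_identity.
have -> : (du u)^T = G *m grad u by rewrite -gradP trmx_mul trmxK GT.
transitivity (\sum_i \sum_q grad u q 0 * curv i p q i).
  rewrite -sumrN; apply: eq_bigr => i _.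
  have -> : \sum_j H i j * (curv i p *m (G *m grad u)) j 0
      = (H *m (curv i p *m G) *m grad u) i 0.
    by rewrite -[in RHS]mulmxA [RHS]mxE; apply: eq_bigr => j _; rewrite mulmxA.
  rewrite -[curv i p *m G]opprK -curv_antisym trmx_mul GT mulmxN (mulmxA H G) HG mul1mx.
  rewrite mulNmx !mxE opprK; apply: eq_bigr => q _.
  by rewrite mxE mulrC.
rewrite exchange_big; apply: eq_bigr => q _ /=; rewrite -mulr_sumr; congr (_ * _).
  by rewrite [RHS]mxE.
by rewrite -[in RHS]ric_sym !mxE.
Qed.

Lemma lapD f h : lap (f + h) = lap f + lap h.
Proof.
rewrite /lap -big_split; apply: eq_bigr => i _; rewrite -big_split /=.
apply: eq_bigr => j _; rewrite -mulrDr; congr (_ * _).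
rewrite !raddfD /= addrACA -opprD; congr (_ - _); rewrite -big_split.
by apply: eq_bigr => k _; rewrite raddfD mulrDr.
Qed.

Lemma lapZ a f : (forall i, D i a = 0) -> lap (a * f) = a * lap f.
Proof.
move=> Da; rewrite /lap mulr_sumr; apply: eq_bigr => i _; rewrite mulr_sumr.
apply: eq_bigr => j _; rewrite mulrCA; congr (_ * _).
rewrite !DM !Da !mul0r !add0r DM Da mul0r add0r mulrBr; congr (_ - _).
by rewrite mulr_sumr; apply: eq_bigr => k _; rewrite DM Da mul0r add0r mulrCA.
Qed.

Lemma lap_sqr u : lap (u * u) = 2 * (u * lap u + gradsq u).
Proof.
have D2 i : D i (u * u) = 2 * (u * D i u) by rewrite DM; ring.
have d2 i : D i (2 : S) = 0 by rewrite raddfMn D_one mul0rn.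
have step i j : D i (D j (u * u)) - \sum_k christ k i j * D k (u * u) =
   2 * (u * (D i (D j u) - \sum_k christ k i j * D k u) + D i u * D j u).
  have -> : \sum_k christ k i j * D k (u * u) = 2 * (u * \sum_k christ k i j * D k u).
    by rewrite !mulr_sumr; apply: eq_bigr => k _; rewrite D2; ring.
  by rewrite D2 DM d2 DM; ring.
rewrite /lap; under eq_bigr => i _ do under eq_bigr => j _ do rewrite step mulrCA mulrDr.
under eq_bigr => i _ do rewrite -mulr_sumr big_split.
rewrite -mulr_sumr big_split; congr (_ * (_ + _)).
  rewrite mulr_sumr; apply: eq_bigr => i _; rewrite mulr_sumr.
  by apply: eq_bigr => j _; rewrite mulrCA.
rewrite /gradsq mulmx_coordE; apply: eq_bigr => i _; rewrite mulmx_coordE mulr_sumr.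
by apply: eq_bigr => j _; rewrite !mxE; ring.
Qed.

Variable s : S.

(** With [s] the inverse square root of [H ord0 ord0] this is the unit normal of the
    hypersurface on which the coordinate [ord0] vanishes. *)
Definition unit_normal : 'rV[S]_N := - s *: row ord0 H.
Definition nabla_unit_normal : 'M[S]_N :=
  \matrix_(i, k) (D i (unit_normal 0 k) + \sum_j christ k i j * unit_normal 0 j).

Lemma unit_normalE k : unit_normal 0 k = - s * H ord0 k.
Proof. by rewrite !mxE. Qed.

Lemma nabla_unit_normalE i k :
  nabla_unit_normal i k = D i (unit_normal 0 k) + \sum_j christ k i j * unit_normal 0 j.
Proof. by rewrite [LHS]mxE. Qed.

Lemma row_nabla_unit_normal i :
  row i nabla_unit_normal = map_mx (D i) unit_normal + unit_normal *m conn i.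
Proof.
apply/rowP => k; rewrite row_coordE [LHS]mxE [RHS]mxE [in RHS]mxE; congr (_ + _).
by rewrite mulmx_coordE; apply: eq_bigr => j _; rewrite [conn _ _ _]mxE mulrC.
Qed.

Lemma unit_normal_metric : unit_normal *m G = - s *: delta_mx 0 ord0.
Proof. by rewrite /unit_normal -scalemxAl -row_mul HG row1. Qed.

(** Along the boundary this trades the Hessian in a normal and a tangential direction
    for the second fundamental form. *)
Lemma D_normal_component u i : D i ((unit_normal *m (du u)^T) 0 0) =
  (nabla_unit_normal *m (du u)^T) i 0 + (hess u *m unit_normal^T) i 0.
Proof.
have -> : D i ((unit_normal *m (du u)^T) 0 0) =
    (map_mx (D i) (unit_normal *m (du u)^T)) 0 0.
  by rewrite [RHS]mxE.
have -> : (nabla_unit_normal *m (du u)^T) i 0 = (row i nabla_unit_normal *m (du u)^T) 0 0.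
  by rewrite -row_mul row_coordE.
have -> : (hess u *m unit_normal^T) i 0 = (unit_normal *m (row i (hess u))^T) 0 0.
  by rewrite -[unit_normal *m _]trmx_scalar11 trmx_mul trmxK -row_mul row_coordE.
rewrite map_mx_derM row_nabla_unit_normal -map_trmx D_du trmxD trmx_mul trmxK.
rewrite mulmxDl mulmxDr mulmxA.
by rewrite !addmx_coordE addrA addrAC.
Qed.

(** Lowering the index makes the normal a multiple of the differential of the
    coordinate [ord0], so that in the other directions only the connection contributes:
    the second fundamental form is a multiple of a Christoffel symbol. *)
Lemma nabla_unit_normal_tangent i b : b != ord0 ->
  (nabla_unit_normal *m G) i b = s * christ ord0 i b.
Proof.
move=> b0.
rewrite -row_coordE row_mul row_nabla_unit_normal mulmxDl.
have -> : map_mx (D i) unit_normal *m G =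
    map_mx (D i) (unit_normal *m G) - unit_normal *m map_mx (D i) G.
  by rewrite map_mx_derM addrK.
rewrite metric_compat mulmxDr !mulmxA unit_normal_metric opprD !addmx_coordE.
have -> : (map_mx (D i) (- s *: delta_mx 0 ord0 : 'rV[S]_N)) 0 b = 0.
  by rewrite !mxE eqxx (negbTE b0) mulr0 raddf0.
rewrite !oppmx_coordE add0r addrAC addNr add0r -scalemxAl -rowE.
by rewrite !mxE mulNr opprK.
Qed.
End DifferentialRing.

(** * Quadratic forms over the reals *)

Lemma neq_lift0 n (b : 'I_n) : lift ord0 b != ord0.
Proof. by rewrite eq_sym neq_lift. Qed.

Section LinearAlgebra.
Context {R : realType}.

Lemma delta_mulmx2 n (K L : 'M[R]_n) a b :
  ((delta_mx 0 a : 'rV_n) *m K *m L *m (delta_mx 0 b : 'rV_n)^T) 0 0 = (K *m L) a b.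
Proof.
rewrite -(mulmxA (delta_mx 0 a : 'rV_n)) -rowE trmx_delta -colE.
by move: (K *m L) => B; rewrite !mxE.
Qed.

Definition qf n (A : 'M[R]_n) (v : 'rV[R]_n) : R := (v *m A *m v^T) 0 0.
Definition posdef n (A : 'M[R]_n) := forall v : 'rV[R]_n, v != 0 -> 0 < qf A v.

Lemma bilE m n (A : 'M[R]_(m, n)) (v : 'rV[R]_m) (w : 'rV_n) :
  (v *m A *m w^T) 0 0 = \sum_i \sum_j v 0 i * w 0 j * A i j.
Proof.
rewrite mxE exchange_big; apply: eq_bigr => j _; rewrite !mxE mulr_suml.
by apply: eq_bigr => i _; ring.
Qed.

Lemma qfE n (A : 'M[R]_n) v : qf A v = \sum_i \sum_j v 0 i * v 0 j * A i j.
Proof. exact: bilE. Qed.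

Lemma qf_delta n (A : 'M[R]_n) i : qf A (delta_mx 0 i) = A i i.
Proof. by rewrite /qf -rowE trmx_delta -colE !mxE. Qed.

Lemma qfZ n (A : 'M[R]_n) a v : qf A (a *: v) = a ^+ 2 * qf A v.
Proof. by rewrite /qf linearZ /= -!scalemxAl -scalemxAr !mxE; ring. Qed.

Lemma posdef_unit n (A : 'M[R]_n) : posdef A -> A \in unitmx.
Proof.
move=> pA; rewrite -row_free_unit -kermx_eq0; apply/rowV0P => v /sub_kermxP vA.
by apply/eqP; apply: contraT => /pA; rewrite /qf vA mul0mx mxE ltxx.
Qed.

Lemma posdef_congr n (A P : 'M[R]_n) : P \in unitmx -> posdef A -> posdef (P *m A *m P^T).
Proof.
move=> uP pA v v0; rewrite /qf !mulmxA -mulmxA -trmx_mul; apply: (pA (v *m P)).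
by apply: contraNneq v0 => vP; rewrite -(mulmxK uP v) vP mul0mx.
Qed.

Lemma posdef_inv n (A : 'M[R]_n) : A^T = A -> posdef A -> posdef (invmx A).
Proof.
move=> sA pA; have uA := posdef_unit pA.
have -> : invmx A = invmx A *m A *m (invmx A)^T.
  by rewrite mulVmx// mul1mx trmx_inv sA.
by apply: posdef_congr => //; rewrite unitmx_inv.
Qed.

(** Cholesky factorization. Completing the square shows that the Schur complement of
    the upper left entry is positive definite, so induction applies to it. *)
Lemma posdef_factor n (A : 'M[R]_n) : A^T = A -> posdef A ->
  exists P : 'M[R]_n, A = P^T *m P.
Proof.
elim: n A => [|n IH] A sA pA; first by exists 0; apply/matrixP => -[].
pose A' : 'M[R]_(1 + n) := A.
pose a := A' 0 0; pose b := ursubmx A'; pose C := drsubmx A'.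
have a0 : 0 < a.
  rewrite /a -[A' 0 0](qf_delta A); apply: pA; apply/eqP => /matrixP/(_ 0 0).
  by rewrite !mxE !eqxx => /eqP; rewrite oner_eq0.
have AE : A' = block_mx a%:M b b^T C.
  rewrite -[A']submxK; congr block_mx.
    by apply/matrixP => i j; rewrite !ord1 !mxE /= mulr1n /a; congr (A' _ _); apply: val_inj.
  by rewrite /b trmx_ursub; congr (dlsubmx _); rewrite /A' sA.
pose S := C - a^-1 *: (b^T *m b).
have sS : S^T = S.
  rewrite /S linearB /= linearZ /= trmx_mul trmxK; congr (_ - _).
  by rewrite /C trmx_drsub; congr (drsubmx _); rewrite /A' sA.
have pS : posdef S.
  move=> v v0; pose w : 'rV[R]_(1 + n) := row_mx (- a^-1 *: (v *m b^T)) v.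
  (* [w] minimizes the form among the rows that end in [v]. *)
  have : 0 < qf A' w.
    apply: pA; apply: contraNneq v0 => w0.
    by have := congr1 (@rsubmx R 1 1 n) w0; rewrite row_mxKr linear0 => ->.
  congr (0 < _); rewrite /qf /w AE mul_row_block tr_row_mx mul_row_col.
  rewrite linearZ /= trmx_mul trmxK.
  have -> : - a^-1 *: (v *m b^T) *m a%:M + v *m b^T = 0.
    rewrite -scalemxAl mul_mx_scalar scalerA mulNr mulVf ?gt_eqF// scaleN1r addNr //.
  rewrite mul0mx add0r; congr (fun_of_matrix _ _ _); congr (_ *m _).
  rewrite /S mulmxBr addrC -scalemxAl -scalemxAr mulmxA; congr (_ + _).
  by rewrite scaleNr.
have [P PE] := IH S sS pS.
pose r := Num.sqrt a; have r0 : r != 0 by rewrite gt_eqF// sqrtr_gt0.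
have rr : r * r = a by rewrite -expr2 sqr_sqrtr// ltW.
exists (block_mx r%:M (r^-1 *: b) 0 P : 'M[R]_(1 + n)).
rewrite -/A' AE (@tr_block_mx _ 1 n 1 n) (@mulmx_block _ 1 n 1 n 1 n).
rewrite !trmx0 !mul0mx !mulmx0 !addr0 tr_scalar_mx -PE.
rewrite -scalar_mxM rr mul_scalar_mx scalerA divff// scale1r.
rewrite linearZ /= mul_mx_scalar scalerA divff// scale1r.
rewrite -scalemxAl -scalemxAr scalerA -invfM rr /S.
by rewrite [_ *: _ + (C - _)]addrC subrK.
Qed.

(** With [H = P^T *m P] the trace is the sum of the values of [qf B] at the rows
    of [P]. *)
Lemma tr_mul_le0 n (H B : 'M[R]_n) : H^T = H -> posdef H ->
  (forall v, qf B v <= 0) -> \tr (H *m B) <= 0.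
Proof.
move=> sH pH B0; have [P ->] := posdef_factor sH pH.
rewrite -mulmxA mxtrace_mulC /mxtrace sumr_le0// => i _.
suff <- : qf B (row i P) = (P *m B *m P^T) i i by exact: B0.
rewrite /qf tr_row colE mulmxA -!row_mul -colE.
by move: (P *m B *m P^T) => M; rewrite !mxE.
Qed.

(** The defect is half the sum of all [(x i - x j) ^+ 2]. *)
Lemma sqr_sum_le n (x : 'I_n -> R) : (\sum_i x i) ^+ 2 <= n%:R * \sum_i x i ^+ 2.
Proof.
have : 0 <= \sum_i \sum_j (x i - x j) ^+ 2.
  by apply: sumr_ge0 => i _; apply: sumr_ge0 => j _; exact: sqr_ge0.
have -> : \sum_i \sum_j (x i - x j) ^+ 2 =
    2 * (n%:R * \sum_i x i ^+ 2 - (\sum_i x i) ^+ 2).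
  transitivity (\sum_i (n%:R * x i ^+ 2 + \sum_j x j ^+ 2 - 2 * x i * \sum_j x j)).
    apply: eq_bigr => i _; rewrite mulr_sumr.
    have -> : n%:R * x i ^+ 2 = \sum_(j < n) x i ^+ 2.
      by rewrite sumr_const card_ord mulr_natl.
    by rewrite -big_split -sumrB; apply: eq_bigr => j _ /=; ring.
  rewrite sumrB big_split /= -mulr_sumr sumr_const card_ord -mulr_suml -mulr_sumr.
  by rewrite -mulr_natl; ring.
by rewrite pmulr_rge0// subr_ge0.
Qed.

(** In a frame that is orthonormal for [H] the right-hand trace is the sum of the
    squares of all entries, and the left-hand one involves the diagonal only. For the
    Hessian of [f] this reads (Delta f)^2 <= N |Hess f|^2. *)
Lemma trace_sqr_le n (H A : 'M[R]_n) : H^T = H -> posdef H -> A^T = A ->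
  \tr (H *m A) ^+ 2 <= n%:R * \tr (H *m A *m (H *m A)).
Proof.
move=> sH pH sA; have [P ->] := posdef_factor sH pH.
pose B := P *m A *m P^T.
have sB : B^T = B by rewrite /B !trmx_mul trmxK sA mulmxA.
have -> : \tr (P^T *m P *m A) = \tr B by rewrite -mulmxA mxtrace_mulC.
have -> : \tr (P^T *m P *m A *m (P^T *m P *m A)) = \sum_i \sum_j B i j ^+ 2.
  have -> : \tr (P^T *m P *m A *m (P^T *m P *m A)) = \tr (B *m B).
    by rewrite -!mulmxA mxtrace_mulC /B !mulmxA.
  rewrite /mxtrace; apply: eq_bigr => i _; rewrite mxE; apply: eq_bigr => j _.
  by rewrite expr2; congr (_ * _); have /matrixP/(_ i j) := sB; rewrite mxE.
apply: (le_trans (sqr_sum_le _)); apply: ler_wpM2l; first exact: ler0n.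
apply: ler_sum => i _; rewrite (bigD1 i)//= lerDl sumr_ge0// => j _; exact: sqr_ge0.
Qed.

(** The inverse metric is the sum of the square of the unit normal and of the inverse
    of the induced metric: the Schur complement of [H ord0 ord0] in [H] inverts the
    tangential block of [G]. *)
Lemma trace_split n (G H A : 'M[R]_n.+1) : G^T = G -> H^T = H -> H *m G = 1%:M ->
  H ord0 ord0 != 0 ->
  let h := \matrix_(a < n, b < n) G (lift ord0 a) (lift ord0 b) in
  let A' := \matrix_(a < n, b < n) A (lift ord0 a) (lift ord0 b) in
  \tr (H *m A^T) = (H ord0 ord0)^-1 * qf A (row ord0 H) + \tr (A' *m invmx h).
Proof.
move=> sG sH HG p0 h A'; set p := H ord0 ord0 in p0 *.
have Hs i j : H i j = H j i by rewrite -{1}sH mxE.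
(* The Schur complement, extended by zero to the normal direction. *)
pose r i j := H i j - p^-1 * (H ord0 i * H ord0 j).
have r0l j : r ord0 j = 0 by rewrite /r mulrA mulVf// mul1r subrr.
have r0r i : r i ord0 = 0 by rewrite /r (Hs i) mulrCA mulVf// mulr1 subrr.
pose k : 'M[R]_n := \matrix_(a, b) r (lift ord0 a) (lift ord0 b).
have HGE i j : \sum_l H i l * G l j = (i == j)%:R.
  by have /matrixP/(_ i j) := HG; rewrite !mxE.
have kh : k *m h = 1%:M.
  apply/matrixP => a b; rewrite !mxE.
  transitivity (\sum_l r (lift ord0 a) l * G l (lift ord0 b)).
    by rewrite big_ord_recl r0r mul0r add0r; apply: eq_bigr => c _; rewrite !mxE.
  under eq_bigr => l _ do rewrite /r mulrBl.
  rewrite sumrB HGE (inj_eq lift_inj).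
  have -> : \sum_l p^-1 * (H ord0 (lift ord0 a) * H ord0 l) * G l (lift ord0 b) =
     p^-1 * H ord0 (lift ord0 a) * \sum_l H ord0 l * G l (lift ord0 b).
    by rewrite mulr_sumr; apply: eq_bigr => l _; ring.
  by rewrite HGE /= mulr0 subr0.
have uh : h \in unitmx by case: (mulmx1_unit kh).
have -> : invmx h = k by rewrite -[invmx h]mul1mx -kh mulmxK.
have -> : \tr (H *m A^T) = \sum_i \sum_j H i j * A i j.
  by apply: eq_bigr => i _; rewrite !mxE; apply: eq_bigr => j _; rewrite mxE.
have -> : \tr (A' *m k) = \sum_i \sum_j r i j * A i j.
  rewrite [RHS]big_ord_recl [X in X + _]big1 ?add0r; last first.
    by move=> j _; rewrite r0l mul0r.
  apply: eq_bigr => a _; rewrite mxE [RHS]big_ord_recl r0r mul0r add0r.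
  by apply: eq_bigr => b _; rewrite !mxE mulrC /r Hs [H ord0 _ * H ord0 _]mulrC.
rewrite qfE mulr_sumr -big_split; apply: eq_bigr => i _ /=.
rewrite mulr_sumr -big_split; apply: eq_bigr => j _ /=.
by rewrite !mxE /r; ring.
Qed.

Lemma continuous_sumr (T : topologicalType) (I : Type) (s : seq I) (f : I -> T -> R) :
  (forall i, continuous (f i)) -> continuous (fun x => \sum_(i <- s) f i x).
Proof.
move=> cf; elim: s => [|i s IH] x.
  rewrite (_ : (fun _ => _) = cst 0); first exact: cst_continuous.
  by apply/funext => y; rewrite big_nil.
rewrite (_ : (fun _ => _) = f i \+ (fun x => \sum_(j <- s) f j x)).
  by apply: continuousD; [exact: cf | exact: IH].
by apply/funext => y; rewrite big_cons.
Qed.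

Lemma qf_continuous n (A : 'M[R]_n.+1) : continuous (qf A : 'rV[R]_n.+1 -> R).
Proof.
rewrite (_ : qf A = fun v => \sum_i \sum_j v 0 i * v 0 j * A i j); last first.
  by apply/funext => v; rewrite qfE.
apply: continuous_sumr => i; apply: continuous_sumr => j v.
have ci l : {for v, continuous (fun v : 'rV[R]_n.+1 => v 0 l)} by exact: coord_continuous.
have cij := @continuousM _ _ (fun v : 'rV[R]_n.+1 => v 0 i) (fun v => v 0 j) v (ci i) (ci j).
exact: (@continuousM _ _ _ (fun=> A i j) v cij (@cst_continuous _ _ _ _)).
Qed.

(** At a zero the form is minimal, so its first variation vanishes in every direction. *)
Lemma psd_kernel n (B : 'M[R]_n) (v : 'rV[R]_n) : B^T = B -> (forall w, 0 <= qf B w) ->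
  qf B v = 0 -> v *m B = 0.
Proof.
move=> sB pB v0; apply/rowP => i; rewrite [RHS]mxE.
pose w : 'rV[R]_n := delta_mx 0 i.
have vw : (v *m B *m w^T) 0 0 = (v *m B) 0 i by rewrite trmx_delta -colE mxE.
rewrite -vw; set b := (v *m B *m w^T) 0 0.
have E t : qf B (v + t *: w) = 2 * t * b + t ^+ 2 * qf B w.
  rewrite /qf linearD /= linearZ /= !mulmxDl !mulmxDr -!scalemxAl -!scalemxAr.
  have wv : (w *m B *m v^T) 0 0 = b.
    rewrite /b; have <- : (w *m B *m v^T)^T = v *m B *m w^T by rewrite !trmx_mul trmxK sB mulmxA.
    by rewrite [RHS]mxE.
  have ad (X Y : 'M[R]_1) : (X + Y) 0 0 = X 0 0 + Y 0 0 by rewrite mxE.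
  have sc (X : 'M[R]_1) a : (a *: X) 0 0 = a * X 0 0 by rewrite mxE.
  rewrite !(ad, sc) wv -/(qf B v) v0 -/(qf B w) -/b; ring.
have [q0|q0] := eqVneq (qf B w) 0.
  have := pB (v + (- b) *: w); rewrite E q0 mulr0 addr0 mulrN mulNr -mulrA oppr_ge0.
  rewrite pmulr_rle0// -expr2 => b2; apply/eqP; rewrite -sqrf_eq0 eq_le b2.
  exact: sqr_ge0.
have qp : 0 < qf B w by rewrite lt_def q0 pB.
(* This multiple of [w] minimizes the quadratic polynomial in [E]. *)
have := pB (v + (- b / qf B w) *: w); rewrite E.
have -> : 2 * (- b / qf B w) * b + (- b / qf B w) ^+ 2 * qf B w = - (b ^+ 2 / qf B w) by field.
rewrite oppr_ge0 pmulr_lle0 ?invr_gt0// => b2.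
by apply/eqP; rewrite -sqrf_eq0 eq_le b2 sqr_ge0.
Qed.

(** The Rayleigh quotient attains its minimum on the unit sphere. A minimizer is an
    eigenvector, being a zero of the nonnegative form of [A - m *: G]. *)
Lemma rayleigh_min n (A G : 'M[R]_n.+1) : A^T = A -> G^T = G -> posdef G ->
  exists2 m, eigenvalue (A *m invmx G) m & forall v, m * qf G v <= qf A v.
Proof.
move=> sA sG pG; pose K := [set v : 'rV[R]_n.+1 | `|v| = 1].
have nz v : K v -> v != 0 by move=> Kv; rewrite -normr_gt0 Kv ltr01.
have cK : compact K.
  apply: bounded_closed_compact.
    by exists 1; split; [exact: num_real|move=> x x1 v /= ->; exact: ltW].
  have -> : K = (fun v : 'rV[R]_n.+1 => `|v|) @^-1` [set 1] by [].
  by apply: closed_comp => [v _|]; [exact: norm_continuous|exact: closed_eq].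
have K0 : K !=set0.
  have v0 : (delta_mx 0 ord0 : 'rV[R]_n.+1) != 0.
    by apply/eqP => /matrixP/(_ 0 ord0); rewrite !mxE !eqxx => /eqP; rewrite oner_eq0.
  exists (`|delta_mx 0 ord0 : 'rV[R]_n.+1|^-1 *: delta_mx 0 ord0).
  by rewrite /K /= normrZ normfV normr_id mulVf// normr_eq0.
have [|v0 /set_mem Kv0 min0] := @EVT_min_rV R n.+1 (fun v => qf A v / qf G v) K K0 cK.
  apply/subspace_continuousP => v Kv; apply: cvg_within_filter.
  apply: (@cvgM _ _ _ _ (qf A) (fun v => (qf G v)^-1)); first exact: qf_continuous.
  by apply: cvgV; [rewrite gt_eqF// pG// nz|exact: qf_continuous].
pose m := qf A v0 / qf G v0.
have mP v : m * qf G v <= qf A v.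
  have [->|vn0] := eqVneq v 0; first by rewrite /qf !mul0mx !mxE mulr0.
  have := min0 (`|v|^-1 *: v); rewrite -/m !qfZ.
  have c0 : (`|v|^-1) ^+ 2 != 0 by rewrite expf_neq0// invr_neq0// normr_eq0.
  rewrite -mulf_div divff// mul1r ler_pdivlMr ?pG//; apply.
  by apply/mem_set; rewrite /K /= normrZ normfV normr_id mulVf// normr_eq0.
exists m => //; apply/eigenvalueP; exists v0; last exact: nz.
pose B := A - m *: G.
have qB v : qf B v = qf A v - m * qf G v.
  by rewrite /qf /B mulmxBr mulmxBl -scalemxAr -scalemxAl !mxE.
have : v0 *m B = 0.
  apply: psd_kernel => [|w|].
  - by rewrite /B linearB /= linearZ /= sA sG.
  - by rewrite qB subr_ge0.
  - by rewrite qB /m mulfVK ?subrr// gt_eqF// pG// nz.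
rewrite /B mulmxBr => /eqP; rewrite subr_eq0 => /eqP v0A.
by rewrite mulmxA v0A -scalemxAr -scalemxAl mulmxK// posdef_unit.
Qed.

End LinearAlgebra.

(** * Differential calculus in several variables *)

Lemma near_eq_differentiable (R : numFieldType) (V W : normedModType R)
    (f g : V -> W) (x : V) :
  (\near x, f x = g x) -> differentiable f x -> differentiable g x.
Proof.
move=> fg /diffP[dc df]; apply/diffP.
apply: (@getPex _ (fun df : {linear V -> W} => continuous df /\
  forall y, g y = g (lim (nbhs x)) + df (y - lim (nbhs x))
                  +o_(y \near x) (y - lim (nbhs x)))).
exists ('d f x); split=> //.
have fgx : f x = g x := nbhs_singleton fg.
have {}df : f = (fun y => f x + 'd f x (y - x)) +o_x (fun y => y - x).
  by rewrite lim_id// in df; apply/funext.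
suff H : g = (fun y => g x + 'd f x (y - x)) +o_x (fun y => y - x).
  by rewrite lim_id// => y; rewrite {1}H.
apply/eqaddoP => e e0; move/eqaddoP: df => /(_ e e0); apply: filter_app.
by apply: filterS fg => y fgy; rewrite !fctE -fgy -fgx.
Qed.

Section Smooth.
Context {R : realType} {n : nat}.
Local Notation E := 'rV[R]_n.+1.
Implicit Types (W : set E) (F G : E -> R^o).

Lemma Ck_ext k W F G : open W -> (forall y, W y -> F y = G y) ->
  Ck k W F -> Ck k W G.
Proof.
move=> oW; elim: k F G => [|k IH] F G FG.
  move=> cF x Wx; have nFG : \near x, F x = G x.
    by apply: filterS (open_nbhs_nbhs (conj oW Wx)) => y /FG.
  have : G @ x --> F x by exact: cvg_trans (near_eq_cvg nFG) (cF x Wx).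
  by rewrite (FG x Wx).
have nFG x : W x -> \near x, F x = G x.
  by move=> Wx; apply: filterS (open_nbhs_nbhs (conj oW Wx)) => y /FG.
move=> [dF CF]; split.
  by move=> x Wx; exact: near_eq_differentiable (nFG x Wx) (dF x Wx).
by move=> v; apply: IH (CF v) => y Wy; apply: near_eq_derive; exact: nFG.
Qed.

Lemma Ck_sub k W W' F : W' `<=` W -> Ck k W F -> Ck k W' F.
Proof.
move=> sW; elim: k F => [|k IH] F; first by move=> cF x /sW; exact: cF.
by move=> [dF CF]; split=> [x /sW|v]; [exact: dF | exact/IH/CF].
Qed.

Lemma Ck_lower k W F : Ck k.+1 W F -> Ck k W F.
Proof.
elim: k F => [|k IH] F [dF CF].
  by move=> x Wx; exact: differentiable_continuous (dF x Wx).
by split=> // v; exact/IH/CF.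
Qed.

Lemma Ck_cst k W (a : R) : Ck k W (cst a : E -> R^o).
Proof.
elim: k a => [|k IH] a; first by move=> x _; exact: cst_continuous.
split=> [x _|v]; first exact: differentiable_cst.
by rewrite (_ : 'D_v _ = cst 0) //; apply/funext => x; rewrite derive_cst.
Qed.

Lemma Ck_D k W F G : open W -> Ck k W F -> Ck k W G -> Ck k W (F \+ G).
Proof.
move=> oW; elim: k F G => [|k IH] F G.
  by move=> cF cG x Wx; exact: (@continuousD _ _ _ F G x (cF x Wx) (cG x Wx)).
move=> [dF CF] [dG CG]; split=> [x Wx|v].
  by apply: differentiableD; [exact: dF|exact: dG].
apply: Ck_ext (IH _ _ (CF v) (CG v)) => // y Wy.
by rewrite /= [RHS]deriveD//; apply: diff_derivable; [exact: dF|exact: dG].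
Qed.

Lemma Ck_M k W F G : open W -> Ck k W F -> Ck k W G -> Ck k W (F \* G).
Proof.
move=> oW; elim: k F G => [|k IH] F G.
  by move=> cF cG x Wx; exact: (@continuousM _ _ F G x (cF x Wx) (cG x Wx)).
move=> CF' CG'; case: (CF') (CG') => [dF CF] [dG CG]; split=> [x Wx|v].
  by apply: differentiableM; [exact: dF|exact: dG].
apply: (@Ck_ext _ _ (('D_v F \* G) \+ (F \* 'D_v G))) => //.
  move=> y Wy /=; rewrite [RHS]deriveM; last 2 first.
  - by apply: diff_derivable; exact: dF.
  - by apply: diff_derivable; exact: dG.
  by rewrite addrC /GRing.scale /= (mulrC (G y)).
apply: Ck_D => //; first exact: IH (CF v) (Ck_lower CG').
exact: IH (Ck_lower CF') (CG v).
Qed.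

(** The induction closes because the derivative of F^(-1/2) is a product of powers of
    F^(-1/2) with the derivative of [F]. *)
Lemma Ck_rsqrt k W F : open W -> (forall y, W y -> 0 < F y) ->
  Ck k.+1 W F -> Ck k W (fun y => (Num.sqrt (F y))^-1 : R^o).
Proof.
move=> oW F0.
have ddiff x : W x -> differentiable F x ->
    differentiable (fun y => (Num.sqrt (F y))^-1 : R^o) x /\
    forall v, 'D_v (fun y => (Num.sqrt (F y))^-1 : R^o) x
      = - 2^-1 * ((Num.sqrt (F x))^-1 * (Num.sqrt (F x))^-1 * (Num.sqrt (F x))^-1) * 'D_v F x.
  move=> Wx dF.
  have Fx := F0 x Wx; have s0 : Num.sqrt (F x) != 0 by rewrite gt_eqF// sqrtr_gt0.
  have ds : is_derive (F x : R^o) 1 (Num.sqrt : R^o -> R^o) (2 * Num.sqrt (F x))^-1.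
    exact: is_derive1_sqrt.
  have dds : differentiable (Num.sqrt : R^o -> R^o) (F x).
    by apply/derivable1_diffP; case: ds.
  have dc : differentiable ((Num.sqrt : R^o -> R^o) \o F) x by exact: differentiable_comp.
  have dV : differentiable (fun y => (Num.sqrt (F y))^-1 : R^o) x.
    exact: (@differentiableV _ _ ((Num.sqrt : R^o -> R^o) \o F)).
  split=> // v.
  rewrite (@deriveV _ _ ((Num.sqrt : R^o -> R^o) \o F))//; last exact: diff_derivable.
  have -> : 'D_v ((Num.sqrt : R^o -> R^o) \o F) x = 'D_v F x * (2 * Num.sqrt (F x))^-1.
    rewrite deriveE// diff_comp//= -(deriveE v dF) -[X in 'd _ _ X]mulr1.
    rewrite -[_ * 1]/(_ *: (1 : R^o)) linearZ /= -deriveE//.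
    by congr (_ *: _); exact: derive_val.
  by rewrite /GRing.scale /=; field.
have C1 : Ck k W F -> (forall x, W x -> differentiable F x) ->
   Ck k W (fun y => (Num.sqrt (F y))^-1 : R^o).
  elim: k => [|k IH] CF dF.
    by move=> x Wx; apply: differentiable_continuous; exact: (ddiff x Wx (dF x Wx)).1.
  split=> [x Wx|v]; first exact: (ddiff x Wx (dF x Wx)).1.
  have CS := IH (Ck_lower CF) dF.
  apply: (@Ck_ext _ _ ((cst (- 2^-1) \* ((fun y => (Num.sqrt (F y))^-1 : R^o)
     \* (fun y => (Num.sqrt (F y))^-1) \* (fun y => (Num.sqrt (F y))^-1))) \* 'D_v F)) => //.
    by move=> y Wy; rewrite (ddiff y Wy (dF y Wy)).2.
  apply: Ck_M => //; last exact: CF.2.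
  apply: Ck_M => //; first exact: Ck_cst.
  by do 2?[apply: Ck_M => //].
by move=> CF; apply: C1; [exact: Ck_lower | exact: CF.1].
Qed.

Lemma is_derive_line F x (u : E) (s : R) : differentiable F (x + s *: u) ->
  is_derive (s : R^o) 1 (fun t : R^o => F (x + t *: u)) ('D_u F (x + s *: u)).
Proof.
move=> /diff_derivable dF.
have E1 : (fun h : R => h^-1 *:
    (((fun t : R^o => F (x + t *: u)) \o shift s) (h *: 1) - F (x + s *: u)))
  = (fun h : R => h^-1 *: ((F \o shift (x + s *: u)) (h *: u) - F (x + s *: u))).
  apply/funext => h /=; congr (_ *: (F _ - _)).
  by rewrite [h *: 1]mulr1 scalerDl addrCA.
split; first by rewrite /derivable E1; exact: dF.
by rewrite /derive E1.
Qed.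

Lemma MVT_line W F x (u : E) (h : R) : 0 < h ->
  (forall s, 0 <= s <= h -> W (x + s *: u)) ->
  (forall y, W y -> differentiable F y) ->
  exists2 s, 0 <= s <= h & F (x + h *: u) - F x = h * 'D_u F (x + s *: u).
Proof.
move=> h0 Wl dF; pose f (t : R^o) : R^o := F (x + t *: u).
have df s : 0 <= s <= h -> is_derive (s : R^o) 1 f ('D_u F (x + s *: u)).
  by move=> /Wl /dF; exact: is_derive_line.
have [||c] := @MVT R f (fun s => 'D_u F (x + s *: u)) 0 h h0.
- by move=> s; rewrite in_itv /= => /andP[/ltW a /ltW b]; apply: df; rewrite a b.
- apply: derivable_within_continuous => s; rewrite in_itv /= => sh.
  by have [] := df s sh.
rewrite in_itv /= => /andP[/ltW c0 /ltW c1] Hc; exists c; rewrite ?c0 ?c1//.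
by move: Hc; rewrite /f scale0r addr0 subr0 mulrC.
Qed.

Lemma near_box (x u v : E) (A : set E) : nbhs x A ->
  exists2 h : R, 0 < h &
    forall s t, 0 <= s <= h -> 0 <= t <= h -> A (x + s *: u + t *: v).
Proof.
move=> /nbhs_normP[e /= e0 eA].
have [c c0 cE] : exists2 c : R, 0 < c & forall r, r * c = r * `|u| + r * `|v| + r.
  exists (`|u| + `|v| + 1); first by rewrite ltr_wpDl// addr_ge0.
  by move=> r; rewrite !mulrDr mulr1.
exists (e / (2 * c)); first by rewrite divr_gt0// mulr_gt0.
move=> s t /andP[s0 sh] /andP[t0 th]; apply: eA => /=.
rewrite -addrA opprD addrA subrr add0r normrN (le_lt_trans (ler_normD _ _))//.
rewrite !normrZ !ger0_norm//.
apply: (@le_lt_trans _ _ (e / (2 * c) * c)).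
  have h0 : 0 < e / (2 * c) by rewrite divr_gt0// mulr_gt0.
  have a1 := ler_wpM2r (normr_ge0 u) sh; have a2 := ler_wpM2r (normr_ge0 v) th.
  rewrite (cE (e / (2 * c))); apply: (le_trans (lerD a1 a2)).
  by rewrite lerDl ltW.
by rewrite invfM mulrA mulfVK ?gt_eqF// gtr_pMr// invf_lt1// ltr1n.
Qed.

Lemma derive_comp_shift F (y p w : E) : 'D_p (F \o shift w) y = 'D_p F (y + w).
Proof.
have E1 : (fun r : R => r^-1 *: ((F \o shift w \o shift y) (r *: p) - (F \o shift w) y))
  = (fun r : R => r^-1 *: ((F \o shift (y + w)) (r *: p) - F (y + w))).
  by apply/funext => r /=; rewrite addrA.
by rewrite /derive E1.
Qed.

Lemma dist_lt_of_eq (a b a' b' d : R) :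
  `|a - a'| < d -> `|b - b'| < d -> a' = b' -> `|a - b| < d + d.
Proof.
move=> ha hb ab; rewrite -(subrKA a') (le_lt_trans (ler_normD _ _))// ltrD//.
by rewrite ab distrC.
Qed.

(** By two applications of the mean value theorem the second difference of [F] over a
    small parallelogram is a value of either mixed derivative at a point nearby, and
    both derivatives are continuous. *)
Lemma Schwarz W F x (u v : E) : open W -> Ck 2 W F -> W x ->
  'D_u ('D_v F) x = 'D_v ('D_u F) x.
Proof.
move=> oW CF Wx; apply/eqP; rewrite -subr_eq0 -normr_eq0; apply/negPn/negP => ne0.
pose e := `|'D_u ('D_v F) x - 'D_v ('D_u F) x| / 2.
have e0 : 0 < e by rewrite divr_gt0// lt_def ne0 normr_ge0.
have cts p q : \forall y \near x, `|'D_p ('D_q F) x - 'D_p ('D_q F) y| < e.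
  by have /cvgrPdist_lt/(_ _ e0) := ((CF.2 q).2 p) x Wx.
have nW : \forall y \near x, W y by exact: open_nbhs_nbhs (conj oW Wx).
have nb : \forall y \near x, (W y /\ `|'D_u ('D_v F) x - 'D_u ('D_v F) y| < e) /\
   `|'D_v ('D_u F) x - 'D_v ('D_u F) y| < e.
  have c1 := cts u v; have c2 := cts v u.
  exact: (filterI (filterI nW c1) c2).
have step p q (h : R) : 0 < h ->
  (forall s t, 0 <= s <= h -> 0 <= t <= h -> W (x + s *: p + t *: q)) ->
  exists s t, [/\ 0 <= s <= h, 0 <= t <= h &
    F (x + h *: p + h *: q) - F (x + h *: p) - (F (x + h *: q) - F x)
      = h * (h * 'D_q ('D_p F) (x + s *: p + t *: q))].
  move=> h0 hW; have hh : 0 <= h <= h by rewrite lexx ltW.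
  have h00 : 0 <= (0 : R) <= h by rewrite lexx ltW.
  (* The second difference is the first difference of [K] in the direction [p]. *)
  pose K (y : E) : R^o := F (y + h *: q) - F y.
  pose W' : set E := [set y | W y /\ W (y + h *: q)].
  have dK y : W' y -> differentiable K y /\ 'D_p K y = 'D_p F (y + h *: q) - 'D_p F y.
    move=> [Wy Wyq].
    have dFs : differentiable (F \o shift (h *: q)) y.
      by apply: differentiable_comp => //; exact: CF.1.
    have dFy := CF.1 _ Wy.
    split; first exact: differentiableB.
    rewrite (@deriveB _ _ _ (F \o shift (h *: q)) F); last 2 first.
    - exact: diff_derivable.
    - exact: diff_derivable.
    by rewrite derive_comp_shift.
  have [|y Wy|s sh Es] := @MVT_line W' K x p h h0.
  - by move=> s sh; split; [have := hW s 0 sh h00; rewrite scale0r addr0|exact: hW].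
  - exact: (dK y Wy).1.
  have [||t th Et] := @MVT_line W ('D_p F) (x + s *: p) q h h0.
  - by move=> t th; exact: hW.
  - exact: (CF.2 p).1.
  exists s, t; split=> //; rewrite -Et; move: Es; rewrite /K => ->.
  by rewrite (dK _ _).2//; split; [have := hW s 0 sh h00; rewrite scale0r addr0|exact: hW].
have [h h0 hA] := near_box u v nb.
have hAW s t : 0 <= s <= h -> 0 <= t <= h -> W (x + s *: u + t *: v).
  by move=> sh th; have [[]] := hA s t sh th.
have hAW' s t : 0 <= s <= h -> 0 <= t <= h -> W (x + s *: v + t *: u).
  by move=> sh th; rewrite addrAC; exact: hAW.
have [s [t [sh th E1]]] := step v u h h0 hAW'.
have [s' [t' [sh' th' E2]]] := step u v h h0 hAW.
rewrite (addrAC x (s *: v)) (addrAC x (h *: v)) in E1.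
have E12 : F (x + h *: u + h *: v) - F (x + h *: v) - (F (x + h *: u) - F x)
    = F (x + h *: u + h *: v) - F (x + h *: u) - (F (x + h *: v) - F x).
  have aux (a b c d : R) : a - b - (c - d) = a - c - (b - d) by ring.
  exact: aux.
have y12 := mulfI (lt0r_neq0 h0) (mulfI (lt0r_neq0 h0)
  (etrans (esym E1) (etrans E12 E2))).
have [[_ l1] _] := hA _ _ th sh; have [_ l2] := hA _ _ sh' th'.
have := dist_lt_of_eq l1 l2 y12.
by rewrite /e -splitr ltxx.
Qed.

Lemma derive_sum_partial F x (v : E) : differentiable F x ->
  'D_v F x = \sum_i v 0 i * 'D_(delta_mx 0 i) F x.
Proof.
move=> dF; rewrite deriveE// {1}(row_sum_delta v) linear_sum.
by apply: eq_bigr => i _; rewrite linearZ /= -deriveE.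
Qed.

Lemma derive2_sum_partial W F x (v : E) : open W -> Ck 2 W F -> W x ->
  'D_v ('D_v F) x =
  \sum_i \sum_j v 0 i * v 0 j * 'D_(delta_mx 0 i) ('D_(delta_mx 0 j) F) x.
Proof.
move=> oW CF Wx; rewrite derive_sum_partial; last exact: (CF.2 v).1.
apply: eq_bigr => i _.
have dj j : differentiable ('D_(delta_mx 0 j) F) x by exact: (CF.2 _).1.
rewrite (@near_eq_derive _ _ _ _ (\sum_(j < n.+1) (v 0 j *: ('D_(delta_mx 0 j) F : E -> R^o)))).
  rewrite derive_sum; last by move=> j; apply: derivableZ; exact: diff_derivable.
  rewrite mulr_sumr; apply: eq_bigr => j _.
  by rewrite deriveZ ?mulrA//; exact: diff_derivable.
apply: filterS (open_nbhs_nbhs (conj oW Wx)) => y Wy.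
by rewrite (derive_sum_partial v (CF.1 y Wy)) fct_sumE.
Qed.

Lemma derive_cvg_right F x (v : E) : derivable F x v ->
  (fun h : R => h^-1 * (F (x + h *: v) - F x)) @ 0^'+ --> ('D_v F x : R).
Proof.
move=> dF.
have -> : (fun h : R => h^-1 * (F (x + h *: v) - F x)) =
   (fun h => h^-1 *: ((F \o shift x) (h *: v) - F x)).
  by apply/funext => h /=; rewrite [x + _]addrC.
apply: cvg_trans dF; apply: cvg_app => A [e egt0 Ae].
by exists e => // y ye ygt0; apply: Ae => //; exact/lt0r_neq0.
Qed.

Lemma max_derive_le0 F x (v : E) (d : R) : derivable F x v -> 0 < d ->
  (forall h, 0 < h < d -> F (x + h *: v) <= F x) -> 'D_v F x <= 0.
Proof.
move=> dF d0 mF; have cF := derive_cvg_right dF.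
rewrite -(cvg_lim _ cF)//; apply: limr_le; first by apply/cvg_ex; exists ('D_v F x).
exists d => //= h; rewrite /= sub0r normrN => hd h0.
apply: mulr_ge0_le0; first by rewrite invr_ge0 ltW.
rewrite subr_le0; apply: mF; rewrite h0 /=.
by rewrite gtr0_norm in hd.
Qed.

(** Otherwise the first derivative along [v] would be positive right after [x], and
    [F] would increase by the mean value theorem. *)
Lemma max_derive2_le0 W F x (v : E) (d : R) : open W -> Ck 2 W F -> W x -> 0 < d ->
  (forall h, 0 < h < d -> F (x + h *: v) <= F x) -> 'D_v F x = 0 ->
  'D_v ('D_v F) x <= 0.
Proof.
move=> oW CF Wx d0 mF DF0; rewrite leNgt; apply/negP => D2.
have cF := derive_cvg_right (diff_derivable (v := v) ((CF.2 v).1 x Wx)).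
have [e /= e0 He] := cvgr_gt _ cF _ D2.
have [h h0 hW] := near_box v 0 (open_nbhs_nbhs (conj oW Wx)).
pose r := Num.min (Num.min (d / 2) (e / 2)) h.
have r0 : 0 < r by rewrite !lt_min h0 !divr_gt0.
have rd : r < d.
  rewrite (@le_lt_trans _ _ (d / 2))// ?ge_min ?lexx//.
  by rewrite gtr_pMr// invf_lt1// ltr1n.
have re : r < e.
  rewrite (@le_lt_trans _ _ (e / 2))// ?ge_min ?lexx ?orbT//.
  by rewrite gtr_pMr// invf_lt1// ltr1n.
have rh : r <= h by rewrite ge_min lexx orbT.
pose f (t : R^o) : R^o := F (x + t *: v).
have hl s : 0 <= s <= r -> W (x + s *: v).
  move=> /andP[s0 sr]; have := hW s 0; rewrite scale0r addr0; apply.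
    by rewrite s0 (le_trans sr).
  by rewrite lexx ltW.
have df s : 0 <= s <= r -> is_derive (s : R^o) 1 f ('D_v F (x + s *: v)).
  by move=> /hl /(CF.1); exact: is_derive_line.
have [||c] := @MVT R f (fun s => 'D_v F (x + s *: v)) 0 r r0.
- by move=> s; rewrite in_itv /= => /andP[/ltW a /ltW b]; apply: df; rewrite a b.
- apply: derivable_within_continuous => s; rewrite in_itv /= => sh.
  by have [] := df s sh.
rewrite in_itv /= => /andP[c0 cr]; rewrite subr0 /f scale0r addr0 => Hc.
have : 0 < 'D_v F (x + c *: v).
  have := He c; rewrite /= sub0r normrN gtr0_norm// DF0 subr0.
  move=> /(_ (lt_trans cr re) c0); rewrite pmulr_rgt0 ?invr_gt0//.
move=> Dpos; have := mF r; rewrite r0 rd => /(_ isT).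
by rewrite -subr_le0 Hc leNgt mulr_gt0.
Qed.
End Smooth.

(** * The ring of smooth functions on a relatively open set *)

Section SmoothOn.
Context {R : realType} {n : nat}.
Local Notation E := 'rV[R]_n.+1.
Implicit Types (U : set E) (f g : E -> R^o).

Lemma smooth_on_eq U f g : smooth_on U f -> (forall y, U y -> f y = g y) ->
  smooth_on U g.
Proof.
move=> sf fg x Ux; have [W [F [oW Wx CF FE]]] := sf x Ux.
by exists W, F; split=> // y Wy Uy; rewrite FE// fg.
Qed.

Lemma smooth_on_cst U (a : R) : smooth_on U (cst a : E -> R^o).
Proof.
move=> x Ux; exists setT, (cst a); split=> //; first exact: openT.
by move=> k; exact: Ck_cst.
Qed.

Lemma smooth_onD U f g : smooth_on U f -> smooth_on U g -> smooth_on U (f \+ g).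
Proof.
move=> sf sg x Ux; have [W [F [oW Wx CF FE]]] := sf x Ux.
have [W' [G [oW' Wx' CG GE]]] := sg x Ux.
have oWW : open (W `&` W') by exact: openI.
exists (W `&` W'), (F \+ G); split=> //.
  move=> k; apply: Ck_D => //.
    by apply: Ck_sub (CF k); exact: subIsetl.
  by apply: Ck_sub (CG k); exact: subIsetr.
by move=> y [Wy Wy'] Uy /=; rewrite FE// GE.
Qed.

Lemma smooth_onM U f g : smooth_on U f -> smooth_on U g -> smooth_on U (f \* g).
Proof.
move=> sf sg x Ux; have [W [F [oW Wx CF FE]]] := sf x Ux.
have [W' [G [oW' Wx' CG GE]]] := sg x Ux.
have oWW : open (W `&` W') by exact: openI.
exists (W `&` W'), (F \* G); split=> //.
  move=> k; apply: Ck_M => //.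
    by apply: Ck_sub (CF k); exact: subIsetl.
  by apply: Ck_sub (CG k); exact: subIsetr.
by move=> y [Wy Wy'] Uy /=; rewrite FE// GE.
Qed.

Lemma smooth_on_rsqrt U f : (forall y, U y -> 0 < f y) -> smooth_on U f ->
  smooth_on U (fun y => (Num.sqrt (f y))^-1 : R^o).
Proof.
move=> f0 sf x Ux; have [W [F [oW Wx CF FE]]] := sf x Ux.
have Fx : 0 < F x by rewrite FE// f0.
have cF : {for x, continuous F} := CF 0%N x Wx.
have [W' [oW' Wx'] W'F] : exists2 W' : set E, open_nbhs x W' &
    W' `<=` [set y | W y /\ 0 < F y].
  have : nbhs x [set y | W y /\ 0 < F y].
    apply: filterI; first exact: open_nbhs_nbhs.
    exact: (cvgr_gt _ cF _ Fx).
  by rewrite nbhsE => -[B oB BA]; exists B.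
exists W', (fun y => (Num.sqrt (F y))^-1); split=> //.
  move=> k; apply: Ck_rsqrt => //; first by move=> y /W'F[].
  by apply: Ck_sub (CF k.+1) => y /W'F[].
by move=> y /W'F[Wy _] Uy; rewrite FE.
Qed.

Lemma half_spaceD (x : E) i (h : R) : half_space x -> 0 <= h ->
  half_space (x + h *: delta_mx 0 i).
Proof.
by move=> x0 h0; rewrite /half_space /= !mxE addr_ge0// mulr_ge0// ler0n.
Qed.

(** Small positive steps stay in the half space; this makes one-sided limits unique. *)
Lemma within_half_proper (x : E) i : half_space x ->
  ProperFilter (within [set h : R | half_space (x + h *: delta_mx 0 i)] 0^').
Proof.
move=> x0; apply: Build_ProperFilter_ex => P [e /= e0 He].
exists (e / 2); apply: He => /=.
- by rewrite sub0r normrN gtr0_norm ?divr_gt0// gtr_pMr// invf_lt1// ltr1n.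
- by rewrite gt_eqF// divr_gt0.
- by apply: half_spaceD => //; rewrite ltW// divr_gt0.
Qed.

Definition rel_open U := exists2 O : set E, open O & U = O `&` half_space.

Section RelOpen.
Variable U : set E.
Hypothesis HU : rel_open U.

Lemma rel_open_half x : U x -> half_space x.
Proof. by case: HU => O oO -> []. Qed.

Lemma near_rel_open x i : U x ->
  \forall h \near within [set h : R | half_space (x + h *: delta_mx 0 i)] 0^',
    U (x + h *: delta_mx 0 i).
Proof.
case: HU => O oO -> [Ox xh].
have c : (fun h : R => x + h *: (delta_mx 0 i : E)) @ (0 : R) --> x.
  rewrite -[X in _ --> X]addr0 -[X in _ + X](scale0r (delta_mx 0 i)).
  by apply: cvgD; [exact: cvg_cst|apply: cvgZr_tmp; exact: cvg_id].
have /= := c O (open_nbhs_nbhs (conj oO Ox)).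
by move=> nO; apply: (@filterS _ (nbhs (0 : R)) _ _ _ _ nO) => h Oh _ hh.
Qed.

(** The difference quotients of the extension [F] have a limit over all steps, hence
    over the admissible ones, for which they are those of [f] near [x]. *)
Lemma partial_ext x i f (W : set E) (F : E -> R^o) : U x -> open W -> W x ->
  differentiable F x -> (forall y, W y -> U y -> F y = f y) ->
  partial i f x = 'D_(delta_mx 0 i) F x.
Proof.
move=> Ux oW Wx dF FE; have xh := rel_open_half Ux.
rewrite /partial; apply: cvg_lim => //.
  exact: (within_half_proper i xh).
have cF : (fun h : R => h^-1 *: ((F \o shift x) (h *: delta_mx 0 i) - F x))
    @ within [set h | half_space (x + h *: delta_mx 0 i)] 0^' --> 'D_(delta_mx 0 i) F x.
  have dv : derivable F x (delta_mx 0 i) by exact: diff_derivable.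
  by apply: cvg_within_filter; exact: dv.
apply: cvg_trans cF; apply: near_eq_cvg.
have c : (fun h : R => x + h *: (delta_mx 0 i : E)) @ (0 : R) --> x.
  rewrite -[X in _ --> X]addr0 -[X in _ + X](scale0r (delta_mx 0 i)).
  by apply: cvgD; [exact: cvg_cst|apply: cvgZr_tmp; exact: cvg_id].
have /= nW0 := c W (open_nbhs_nbhs (conj oW Wx)).
have nW : \forall h \near within [set h : R | half_space (x + h *: delta_mx 0 i)] 0^',
    W (x + h *: delta_mx 0 i).
  by apply: (@filterS _ (nbhs (0 : R)) _ _ _ _ nW0) => h Wh _ _.
apply: filterS2 (near_rel_open i Ux) nW => h Uh Wh.
by rewrite /= [_ *: _ + _]addrC FE// FE.
Qed.

Lemma partial_eq x i f g : U x -> (forall y, U y -> f y = g y) ->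
  partial i f x = partial i g x.
Proof.
move=> Ux fg; rewrite /partial; congr (lim _).
rewrite eqEsubset; split; apply: near_eq_cvg;
  by apply: filterS (near_rel_open i Ux) => h Uh; rewrite !fg.
Qed.

Lemma smooth_on_extension x f : U x -> smooth_on U f -> exists W F,
  [/\ open W, W x, forall k, Ck k W F, forall y, W y -> U y -> F y = f y &
   (forall y i, W y -> U y -> partial i f y = 'D_(delta_mx 0 i) F y)].
Proof.
move=> Ux sf; have [W [F [oW Wx CF FE]]] := sf x Ux.
exists W, F; split=> // y i Wy Uy.
exact: (partial_ext i Uy oW Wy ((CF 1%N).1 y Wy) FE).
Qed.

Lemma smooth_on_partial i f : smooth_on U f -> smooth_on U (partial i f : E -> R^o).
Proof.
move=> sf x Ux; have [W [F [oW Wx CF _ PF]]] := smooth_on_extension Ux sf.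
exists W, ('D_(delta_mx 0 i) F); split=> //; first by move=> k; exact: (CF k.+1).2.
by move=> y Wy Uy; rewrite PF.
Qed.

Lemma partialD i f g x : U x -> smooth_on U f -> smooth_on U g ->
  partial i (f \+ g) x = partial i f x + partial i g x.
Proof.
move=> Ux sf sg; have [W [F [oW Wx CF FE PF]]] := smooth_on_extension Ux sf.
have [W' [G [oW' Wx' CG GE PG]]] := smooth_on_extension Ux sg.
have dF := (CF 1%N).1 x Wx; have dG := (CG 1%N).1 x Wx'.
rewrite (PF x i)// (PG x i)// -deriveD; [|exact: diff_derivable..].
apply: (@partial_ext x i (f \+ g) (W `&` W') (F + G) Ux (openI oW oW') (conj Wx Wx')).
  exact: differentiableD.
by move=> y [Wy Wy'] Uy; rewrite -[LHS]/(F y + G y) FE// GE.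
Qed.

Lemma partialM i f g x : U x -> smooth_on U f -> smooth_on U g ->
  partial i (f \* g) x = partial i f x * g x + f x * partial i g x.
Proof.
move=> Ux sf sg; have [W [F [oW Wx CF FE PF]]] := smooth_on_extension Ux sf.
have [W' [G [oW' Wx' CG GE PG]]] := smooth_on_extension Ux sg.
have dF := (CF 1%N).1 x Wx; have dG := (CG 1%N).1 x Wx'.
rewrite (PF x i)// (PG x i)// -FE// -GE//.
rewrite [RHS]addrC [X in _ + X]mulrC -[RHS]/(F x *: _ + G x *: _).
rewrite -deriveM; [|exact: diff_derivable..].
apply: (@partial_ext x i (f \* g) (W `&` W') (F * G) Ux (openI oW oW') (conj Wx Wx')).
  exact: differentiableM.
by move=> y [Wy Wy'] Uy; rewrite -[LHS]/(F y * G y) FE// GE.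
Qed.

Lemma partialC i j f x : U x -> smooth_on U f ->
  partial i (partial j f) x = partial j (partial i f) x.
Proof.
move=> Ux sf; have [W [F [oW Wx CF FE PF]]] := smooth_on_extension Ux sf.
have H k l : partial k (partial l f) x = 'D_(delta_mx 0 k) ('D_(delta_mx 0 l) F) x.
  apply: (partial_ext k Ux oW Wx); first exact: ((CF 2%N).2 _).1.
  by move=> y Wy Uy; rewrite PF.
by rewrite !H; exact: (Schwarz _ _ oW (CF 2%N) Wx).
Qed.

End RelOpen.
End SmoothOn.

Section SmoothRing.
Context {R : realType} {n : nat}.
Local Notation E := 'rV[R]_n.+1.
Variable U : set E.

(** Functions on this type are determined by their values on [U], so that the rules
    of differentiation become equalities in a ring of functions. *)
Definition points := {x : E | U x}.

Definition extend0 (f : points -> R) : E -> R^o := fun x =>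
  if pselect (U x) is left p then f (exist _ x p) else 0.

Lemma extend0E (f : points -> R) x (p : U x) : extend0 f x = f (exist _ x p).
Proof.
by rewrite /extend0; case: pselect => // q; rewrite (Prop_irrelevance p q).
Qed.

Definition smooth_pred : {pred (points -> R)} := fun f => `[< smooth_on U (extend0 f) >].

Lemma smooth_predP f : reflect (smooth_on U (extend0 f)) (f \in smooth_pred).
Proof. exact: asboolP. Qed.

Lemma smooth_pred_subring : subring_closed smooth_pred.
Proof.
have sM : {in smooth_pred &, forall f g, f * g \in smooth_pred}.
  move=> f g /smooth_predP sf /smooth_predP sg; apply/smooth_predP.
  have sfg := smooth_onM sf sg.
  by apply: (smooth_on_eq sfg) => y Uy; rewrite /= !(extend0E _ Uy).
split=> //.
- apply/smooth_predP; have s1 := @smooth_on_cst R n U 1.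
  by apply: (smooth_on_eq s1) => y Uy; rewrite extend0E.
- move=> f g /smooth_predP sf /smooth_predP sg; apply/smooth_predP.
  have sfg := smooth_onD sf (smooth_onM (@smooth_on_cst R n U (-1)) sg).
  apply: (smooth_on_eq sfg) => y Uy.
  by rewrite /= !(extend0E _ Uy) mulN1r.
Qed.
HB.instance Definition _ :=
  GRing.isSubringClosed.Build (points -> R) smooth_pred smooth_pred_subring.

Record smooth := Smooth { sval_smooth : points -> R; _ : sval_smooth \in smooth_pred }.
HB.instance Definition _ := [isSub for sval_smooth].
HB.instance Definition _ := [Choice of smooth by <:].
HB.instance Definition _ := GRing.SubChoice_isSubComPzRing.Build
  (points -> R) smooth_pred smooth smooth_pred_subring.

Lemma smooth_valP (s : smooth) : smooth_on U (extend0 (val s)).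
Proof. exact/smooth_predP/valP. Qed.

Fact mk_smooth_subproof (f : E -> R^o) : smooth_on U f ->
  (fun t : points => f (sval t)) \in smooth_pred.
Proof.
move=> sf; apply/smooth_predP; apply: (smooth_on_eq sf) => y Uy.
by rewrite extend0E.
Qed.

Definition mk_smooth f (sf : smooth_on U f) : smooth :=
  Smooth (mk_smooth_subproof sf).

Definition ev (t : points) (s : smooth) : R := val s t.

Fact ev_zmod t : zmod_morphism (ev t). Proof. by []. Qed.
Fact ev_monoid t : monoid_morphism (ev t). Proof. by []. Qed.
HB.instance Definition _ t :=
  GRing.isZmodMorphism.Build smooth R (ev t) (ev_zmod t).
HB.instance Definition _ t :=
  GRing.isMonoidMorphism.Build smooth R (ev t) (ev_monoid t).

Lemma smoothP (s s' : smooth) : (forall t, ev t s = ev t s') -> s = s'.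
Proof. by move=> e; apply/val_inj/funext. Qed.

(** Identities in the ring are read through this relation as identities between
    functions of the coordinates. *)
Definition represents (s : smooth) (f : E -> R) :=
  forall x (p : U x), ev (exist _ x p) s = f x.

Lemma rep_mk f (sf : smooth_on U f) : represents (mk_smooth sf) f.
Proof. by []. Qed.

Lemma rep_extend0 s : represents s (extend0 (val s)).
Proof. by move=> x p; rewrite extend0E. Qed.

Lemma rep_smooth s f : represents s f -> smooth_on U (f : E -> R^o).
Proof.
move=> sf; apply: (smooth_on_eq (smooth_valP s)) => y Uy.
by rewrite extend0E -(sf y Uy).
Qed.

Hypothesis HU : rel_open U.

Definition smooth_der (i : 'I_n.+1) (s : smooth) : smooth :=
  mk_smooth (smooth_on_partial HU i (smooth_valP s)).

Lemma rep_smooth_der i s f : represents s f -> represents (smooth_der i s) (partial i f).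
Proof.
move=> sf x p; rewrite /smooth_der rep_mk; apply: (partial_eq HU i p) => y Uy.
by rewrite extend0E -(sf y Uy).
Qed.

Fact smooth_der_zmod i : zmod_morphism (smooth_der i).
Proof.
move=> s s'; apply: smoothP => -[x p]; rewrite raddfB /= !(rep_smooth_der _ (rep_extend0 _)).
(* Additivity for [s - s'] and [s'] gives compatibility with subtraction. *)
rewrite -[in RHS](subrK s' s).
have -> : partial i (extend0 (val (s - s' + s'))) x =
  partial i (extend0 (val (s - s')) \+ extend0 (val s')) x.
  by apply: (partial_eq HU i p) => y Uy; rewrite /= !extend0E.
by rewrite (partialD HU) ?addrK//; exact: smooth_valP.
Qed.
HB.instance Definition _ i :=
  GRing.isZmodMorphism.Build smooth smooth (smooth_der i) (smooth_der_zmod i).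

Lemma smooth_derM i s s' :
  smooth_der i (s * s') = smooth_der i s * s' + s * smooth_der i s'.
Proof.
apply: smoothP => -[x p]; rewrite !(rmorphD, rmorphM) /= !(rep_smooth_der _ (rep_extend0 _)) //.
have -> : partial i (extend0 (val (s * s'))) x =
  partial i (extend0 (val s) \* extend0 (val s')) x.
  by apply: (partial_eq HU i p) => y Uy; rewrite /= !extend0E.
rewrite (partialM HU)//; [|exact: smooth_valP..].
by rewrite !(rep_extend0 _ p).
Qed.

Lemma smooth_derC i j s : smooth_der i (smooth_der j s) = smooth_der j (smooth_der i s).
Proof.
apply: smoothP => -[x p].
rewrite !(rep_smooth_der _ (rep_smooth_der _ (rep_extend0 s))).
exact: (partialC HU i j p (smooth_valP s)).
Qed.

End SmoothRing.

(** * Maxima on a relatively open set of the half space *)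

Section MaxRelOpen.
Context {R : realType} {n : nat}.
Local Notation E := 'rV[R]_n.+1.
Variable U : set E.
Hypothesis HU : rel_open U.

Lemma partial_cst i x (a : R) : U x -> partial i (cst a : E -> R) x = 0.
Proof.
move=> Ux; rewrite (@partial_ext _ _ _ HU x i (cst a) setT (cst a) Ux)//.
- by rewrite derive_cst.
- exact: openT.
Qed.

(** Tangential steps stay in the boundary, so the difference quotients vanish. *)
Lemma partial_tangent i x (f : E -> R) : U x -> x 0 ord0 = 0 -> i != ord0 ->
  (forall y, U y -> y 0 ord0 = 0 -> f y = 0) -> partial i f x = 0.
Proof.
move=> Ux x0 i0 f0; rewrite -(partial_cst i 0 Ux) /partial; congr (lim _).
have H : \forall h \near within [set h : R | half_space (x + h *: delta_mx 0 i)] 0^',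
    h^-1 * (f (x + h *: delta_mx 0 i) - f x) =
    h^-1 * ((cst 0 : E -> R) (x + h *: delta_mx 0 i) - (cst 0 : E -> R) x).
  apply: filterS (near_rel_open HU i Ux) => h Uh.
  by rewrite !f0// !mxE x0 eqxx eq_sym (negbTE i0) mulr0 addr0.
rewrite eqEsubset; split; apply: near_eq_cvg => //.
by apply: filterS H => h ->.
Qed.

(** The directions in which one can leave [x] without leaving the half space at once. *)
Definition inward (x v : E) := 0 < x 0 ord0 \/ 0 <= v 0 ord0.

Lemma inward_segment x v (W : set E) : U x -> open W -> W x -> inward x v ->
  exists2 d : R, 0 < d & forall h, 0 < h < d -> U (x + h *: v) /\ W (x + h *: v).
Proof.
case: HU => O oO UE; rewrite UE => -[Ox hx] oW Wx inw.
have oOW : nbhs x (O `&` W) by apply: filterI; apply: open_nbhs_nbhs.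
have [e e0 He] := near_box v 0 oOW.
have [r r0 Hr] : exists2 r : R, 0 < r & forall h, 0 < h < r -> half_space (x + h *: v).
  case: inw => [x0|v0].
    exists (x 0 ord0 / (`|v 0 ord0| + 1)).
      by rewrite divr_gt0// ltr_wpDl.
    move=> h /andP[h0]; rewrite ltr_pdivlMr ?ltr_wpDl// => hr.
    rewrite /half_space /= !mxE -lerBlDl sub0r.
    apply: (le_trans _ (_ : - (h * `|v 0 ord0|) <= _)).
      by rewrite lerN2 ltW// (le_lt_trans _ hr)// ler_pM2l// lerDl.
    by rewrite -mulrN ler_pM2l// lerNl -normrN ler_norm.
  exists 1 => // h /andP[h0 _]; rewrite /half_space /= !mxE.
  by apply: addr_ge0 => //; apply: mulr_ge0 => //; exact: ltW.
exists (Num.min e r); first by rewrite lt_min e0.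
move=> h /andP[h0]; rewrite lt_min => /andP[he hr].
have : (O `&` W) (x + h *: v).
  by have := He h 0; rewrite scale0r addr0; apply; rewrite ?lexx ?(ltW h0) ?(ltW he) ?(ltW e0).
by move=> [Oh Wh]; split=> //; split=> //; apply: Hr; rewrite h0.
Qed.

Section AtMax.
Variables (F : E -> R^o) (x : E).
Hypothesis sF : smooth_on U F.
Hypothesis Ux : U x.
Hypothesis maxF : forall y, U y -> F y <= F x.

(** Steps of either sign are admissible here. *)
Lemma max_partial_eq0 k : 0 < x 0 ord0 \/ k != ord0 -> partial k F x = 0.
Proof.
move=> xk; have [W [G [oW Wx CG GE PG]]] := smooth_on_extension HU Ux sF.
have dG := (CG 1%N).1 x Wx.
have le0 v : inward x v -> 'D_v G x <= 0.
  move=> /(inward_segment Ux oW Wx)[d d0 Hd].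
  apply: (max_derive_le0 (diff_derivable dG) d0) => h /Hd[Uh Wh].
  by rewrite !GE// maxF.
have iw (a : R) : inward x (a *: delta_mx 0 k).
  case: xk => [?|k0]; [by left|right].
  by rewrite !mxE eqxx eq_sym (negbTE k0) mulr0.
rewrite PG//; apply/eqP; rewrite eq_le -[delta_mx 0 k]scale1r le0//= .
have := le0 _ (iw (-1)); rewrite !deriveE// !linearZ /= scale1r.
by rewrite scaleN1r oppr_le0.
Qed.

Lemma max_partial_le0 : x 0 ord0 = 0 -> partial ord0 F x <= 0.
Proof.
move=> x0; have [W [G [oW Wx CG GE PG]]] := smooth_on_extension HU Ux sF.
have dG := (CG 1%N).1 x Wx; rewrite PG//.
have /(inward_segment Ux oW Wx)[d d0 Hd] : inward x (delta_mx 0 ord0).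
  by right; rewrite !mxE !eqxx.
apply: (max_derive_le0 (diff_derivable dG) d0) => h /Hd[Uh Wh].
by rewrite !GE// maxF.
Qed.

(** One of [v] and [- v] is inward, and a quadratic form does not distinguish them. *)
Lemma max_hessian_le0 (v : E) : (forall k, partial k F x = 0) ->
  \sum_i \sum_j v 0 i * v 0 j * partial i (partial j F) x <= 0.
Proof.
move=> DF0; have [W [G [oW Wx CG GE PG]]] := smooth_on_extension HU Ux sF.
have dG := (CG 1%N).1 x Wx.
have D2 i j : partial i (partial j F) x = 'D_(delta_mx 0 i) ('D_(delta_mx 0 j) G) x.
  apply: (partial_ext HU i Ux oW Wx); first exact: ((CG 2%N).2 _).1.
  by move=> y Wy Uy; rewrite PG.
have main w : inward x w -> \sum_i \sum_j w 0 i * w 0 j * partial i (partial j F) x <= 0.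
  move=> /(inward_segment Ux oW Wx)[d d0 Hd].
  under eq_bigr => i _ do under eq_bigr => j _ do rewrite D2.
  rewrite -(derive2_sum_partial w oW (CG 2%N) Wx).
  apply: (max_derive2_le0 oW (CG 2%N) Wx d0).
    by move=> h /Hd[Uh Wh]; rewrite !GE// maxF.
  rewrite derive_sum_partial// big1// => i _.
  by rewrite -(PG x i)// DF0 mulr0.
have [v0|/ltW v0] := leP 0 (v 0 ord0); first by apply: main; right.
have := main (- v); rewrite /inward mxE oppr_ge0 => /(_ (or_intror v0)).
by under eq_bigr => i _ do under eq_bigr => j _ do rewrite !mxE mulrNN.
Qed.

End AtMax.
End MaxRelOpen.

(** * The energy density in a chart *)

Section Chart.
Context {R : realType} {n : nat} {M : topologicalType} {A : manifold R n M}.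
Variables (g : metric A) (c : chart R n M).
Hypothesis Ac : atlas A c.
Local Notation E := 'rV[R]_n.+1.
Local Notation U := (chart_image c).
Local Notation S := (smooth U).

Lemma chart_rel_open : rel_open U. Proof. exact: chart_image_open. Qed.

Definition dS (i : 'I_n.+1) : {additive S -> S} := smooth_der chart_rel_open i.
Definition constS (a : R) : S := mk_smooth (@smooth_on_cst R n U a).
Definition gramS : 'M[S]_n.+1 := \matrix_(i, j) mk_smooth (gram_smooth g i j Ac).

Lemma dSM i a b : dS i (a * b) = dS i a * b + a * dS i b.
Proof. exact: smooth_derM. Qed.
Lemma dSC i j a : dS i (dS j a) = dS j (dS i a).
Proof. exact: smooth_derC. Qed.
Lemma rep_dS i s f : represents s f -> represents (dS i s) (partial i f).
Proof. exact: rep_smooth_der. Qed.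
Lemma dS_constS i a : dS i (constS a) = 0.
Proof.
apply: smoothP => -[x p]; rewrite (rep_dS i (@rep_mk _ _ _ _ (@smooth_on_cst R n U a))).
by rewrite (partial_cst chart_rel_open) // raddf0.
Qed.

Lemma half_constS : constS 2^-1 + constS 2^-1 = 1.
Proof.
apply: smoothP => -[x p]; rewrite rmorphD rmorph1 /= !(rep_mk (@smooth_on_cst R n U 2^-1)) /=.
by rewrite /cst; field.
Qed.

Lemma gramS_sym : gramS^T = gramS.
Proof.
apply/matrixP => i j; rewrite !mxE; apply: smoothP => -[x p].
rewrite !(rep_mk (gram_smooth g _ _ Ac)).
by have /matrixP/(_ i j) := gram_sym g Ac p; rewrite mxE.
Qed.

Lemma gram_pd x : U x -> posdef (g c x).
Proof. by move=> Ux v v0; exact: gram_posdef. Qed.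

Lemma gram_unit x : U x -> g c x \in unitmx.
Proof. by move=> /gram_pd; exact: posdef_unit. Qed.

Lemma ev_gramS (t : points U) : map_mx (ev t) gramS = g c (sval t).
Proof. by apply/matrixP => i j; rewrite !mxE; case: t => x p. Qed.

Lemma ev_det (t : points U) : ev t (\det gramS) = \det (g c (sval t)).
Proof. by rewrite -ev_gramS det_map_mx. Qed.

Lemma rep_det : represents (\det gramS) (fun x => \det (g c x)).
Proof. by move=> x p; rewrite ev_det. Qed.

Lemma det_sq_gt0 x : U x -> 0 < \det (g c x) * \det (g c x).
Proof.
move=> Ux; rewrite -expr2 lt_def sqr_ge0 andbT sqrf_eq0.
by have := gram_unit Ux; rewrite unitmxE unitfE.
Qed.

Lemma smooth_det2 : smooth_on U ((fun x => \det (g c x) * \det (g c x)) : E -> R^o).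
Proof. by apply: smooth_onM; exact: rep_smooth rep_det. Qed.

(** The inverse of the determinant, in the form det * (1 / sqrt (det^2))^2 whose
    smoothness follows from [smooth_on_rsqrt]. *)
Definition inv_detS : S :=
  let r := mk_smooth (smooth_on_rsqrt det_sq_gt0 smooth_det2) in r * r * \det gramS.

Lemma inv_detSP : inv_detS * \det gramS = 1.
Proof.
apply: smoothP => -[x p]; rewrite !rmorphM rmorph1 /= !(rep_det p).
rewrite (rep_mk (smooth_on_rsqrt det_sq_gt0 smooth_det2)).
have d0 := det_sq_gt0 p; set d := \det _ in d0 *.
by rewrite -invfM -expr2 sqr_sqrtr ?ltW// -mulrA mulVf// gt_eqF.
Qed.

Definition cometricS : 'M[S]_n.+1 := inv_detS *: \adj gramS.

Lemma cometricS_gramS : cometricS *m gramS = 1%:M.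
Proof. by rewrite /cometricS -scalemxAl mul_adj_mx scale_scalar_mx inv_detSP. Qed.

Lemma ev_cometricS (t : points U) : map_mx (ev t) cometricS = cometric g c (sval t).
Proof.
have := congr1 (map_mx (ev t)) cometricS_gramS; rewrite map_mxM map_mx1 ev_gramS => e.
have ug : g c (sval t) \in unitmx by case: t {e} => x p; exact: gram_unit.
by rewrite /cometric -[LHS](mulmxK ug) e mul1mx.
Qed.

Lemma rep_gramS i j : represents (gramS i j) (fun y => g c y i j).
Proof. by move=> x p; have /matrixP/(_ i j) := ev_gramS (exist _ x p); rewrite mxE. Qed.
Lemma rep_cometricS i j : represents (cometricS i j) (fun y => cometric g c y i j).
Proof. by move=> x p; have /matrixP/(_ i j) := ev_cometricS (exist _ x p); rewrite mxE. Qed.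

Lemma cometric_sym x : U x -> (cometric g c x)^T = cometric g c x.
Proof. by move=> Ux; rewrite /cometric trmx_inv gram_sym. Qed.

Lemma cometric_pd x : U x -> posdef (cometric g c x).
Proof. by move=> Ux; apply: posdef_inv; [exact: gram_sym|exact: gram_pd]. Qed.

Lemma cometric00_gt0 x : U x -> 0 < cometric g c x ord0 ord0.
Proof.
move=> /cometric_pd pd; rewrite -qf_delta; apply: pd.
by apply/eqP => /matrixP/(_ 0 ord0); rewrite !mxE !eqxx => /eqP; rewrite oner_eq0.
Qed.

Lemma smooth_rsqrt_cometric : smooth_on U
  ((fun x => (Num.sqrt (cometric g c x ord0 ord0))^-1) : E -> R^o).
Proof. exact: smooth_on_rsqrt cometric00_gt0 (rep_smooth (rep_cometricS ord0 ord0)). Qed.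

Definition rsqrtS : S := mk_smooth smooth_rsqrt_cometric.

Local Notation christS := (christ dS (constS 2^-1) gramS cometricS).
Local Notation ricS := (ric dS (constS 2^-1) gramS cometricS).
Local Notation lapS := (lap dS (constS 2^-1) gramS cometricS).
Local Notation hessS := (hess dS (constS 2^-1) gramS cometricS).
Local Notation duS := (du dS).
Local Notation gradS := (grad dS cometricS).
Local Notation gradsqS := (gradsq dS cometricS).
Local Notation normalS := (unit_normal cometricS rsqrtS).
Local Notation nabla_normalS := (nabla_unit_normal dS (constS 2^-1) gramS cometricS rsqrtS).

Lemma rep_christ k i j : represents (christS k i j) (christoffel g c k i j).
Proof.
move=> x p; rewrite /christ rmorphM rmorph_sum /= (rep_mk (@smooth_on_cst R n U 2^-1)) /=.
congr (_ * _); apply: eq_bigr => l _; rewrite rmorphM rmorphB rmorphD /= (rep_cometricS _ _ p).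
by rewrite !(rep_dS _ (rep_gramS _ _)).
Qed.

Lemma ev_ric (t : points U) : map_mx (ev t) ricS = ricci g c (sval t).
Proof.
case: t => x p; apply/matrixP => j k; rewrite !mxE rmorph_sum; apply: eq_bigr => i _.
rewrite /curv !mxE !(rmorphD, rmorphB, rmorphN) /= /riemann.
rewrite !(rep_dS _ (rep_christ _ _ _)) !rmorph_sum sumrB /=.
congr (_ - _ + (_ - _)); apply: eq_bigr => m _; rewrite !mxE rmorphM /=.
  by rewrite !rep_christ.
by rewrite !rep_christ.
Qed.

Lemma ricci_sym x : U x -> (ricci g c x)^T = ricci g c x.
Proof.
move=> p; rewrite -[x]/(sval (exist _ x p : points U)) -ev_ric map_trmx.
by rewrite (ric_sym dSM dSC half_constS gramS_sym cometricS_gramS).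
Qed.

Lemma rep_unit_normal k : represents (normalS 0 k) (fun y => outward_normal g c y 0 k).
Proof.
move=> x p; rewrite unit_normalE rmorphM rmorphN /= (rep_cometricS _ _ p) /outward_normal !mxE.
by rewrite (rep_mk smooth_rsqrt_cometric) mulNr.
Qed.

Lemma ev_nabla_unit_normal (t : points U) :
  map_mx (ev t) nabla_normalS = nabla_normal g c (sval t).
Proof.
case: t => x p; apply/matrixP => i k; rewrite [LHS]mxE nabla_unit_normalE [RHS]mxE.
rewrite rmorphD rmorph_sum /=.
rewrite (rep_dS i (rep_unit_normal k) p); congr (_ + _); apply: eq_bigr => j _.
by rewrite rmorphM /= (rep_christ _ _ _ p) (rep_unit_normal _ p).
Qed.

Lemma ev_unit_normal (t : points U) : map_mx (ev t) normalS = outward_normal g c (sval t).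
Proof. by case: t => x p; apply/rowP => k; rewrite mxE (rep_unit_normal _ p). Qed.

Lemma second_form_mxE x (a b : 'I_n) : second_form_mx g c x a b =
  (nabla_normal g c x *m g c x) (lift ord0 a) (lift ord0 b).
Proof. by rewrite mxE; exact: delta_mulmx2. Qed.

Section Fun.
Variable f : M -> R.
Hypothesis sf : smooth_on U (f \o chart_inv c : E -> R^o).

Definition funS : S := mk_smooth sf.
Local Notation u := (f \o chart_inv c : E -> R).

Definition chart_du (x : E) : E := \row_k partial k u x.

Lemma rep_funS : represents funS u. Proof. exact: rep_mk. Qed.

Lemma ev_du (t : points U) : map_mx (ev t) (duS funS) = chart_du (sval t).
Proof. by case: t => x p; apply/rowP => k; rewrite !mxE (rep_dS _ rep_funS). Qed.

Lemma rep_lap : represents (lapS funS) (laplacian g c f).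
Proof.
move=> x p; rewrite /lap rmorph_sum; apply: eq_bigr => i _; rewrite rmorph_sum.
apply: eq_bigr => j _; rewrite rmorphM /= (rep_cometricS _ _ p) rmorphB rmorph_sum /=.
rewrite (rep_dS _ (rep_dS _ rep_funS)); congr (_ * (_ - _)).
by apply: eq_bigr => k _; rewrite rmorphM /= (rep_christ _ _ _ p) (rep_dS _ rep_funS).
Qed.

Definition gradnorm2 (x : E) : R := qf (cometric g c x) (chart_du x).

Lemma rep_gradsq : represents (gradsqS funS) gradnorm2.
Proof.
move=> x p; have /matrixP/(_ 0 0) : map_mx (ev (exist _ x p)) (duS funS *m gradS funS)
   = chart_du x *m cometric g c x *m (chart_du x)^T.
  by rewrite /grad !map_mxM -map_trmx ev_du ev_cometricS mulmxA.
by rewrite mxE.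
Qed.

Definition chart_grad (x : E) : E := chart_du x *m cometric g c x.
Definition chart_hess (t : points U) : 'M[R]_n.+1 :=
  map_mx (ev t) (hessS funS).

Lemma ev_grad (t : points U) : map_mx (ev t) (gradS funS) = (chart_grad (sval t))^T.
Proof.
rewrite /grad map_mxM -map_trmx ev_du ev_cometricS /chart_grad trmx_mul cometric_sym //.
by case: t.
Qed.

Lemma chart_grad_gram x : U x -> chart_grad x *m g c x = chart_du x.
Proof. by move=> Ux; rewrite /chart_grad /cometric mulmxKV// gram_unit. Qed.

Lemma gradnorm2_grad x : U x -> gradnorm2 x = qf (g c x) (chart_grad x).
Proof.
move=> Ux; rewrite /gradnorm2 /qf chart_grad_gram// /chart_grad trmx_mul mulmxA.
by rewrite cometric_sym.
Qed.

Lemma chart_hess_sym t : (chart_hess t)^T = chart_hess t.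
Proof. by rewrite /chart_hess map_trmx (hess_sym dSC _ _ gramS_sym). Qed.

Variable lam : R.
Hypothesis eig : forall x, U x -> laplacian g c f x = - lam * u x.

Lemma lap_funS : lapS funS = constS (- lam) * funS.
Proof.
by apply: smoothP => -[x p]; rewrite (rep_lap p) eig.
Qed.

Variable a : R.
Definition energyS : S := gradsqS funS + constS a * (funS * funS).
(** The function to which the maximum principle is applied. *)
Definition energy (x : E) : R := gradnorm2 x + a * (u x * u x).

Lemma rep_energy : represents energyS energy.
Proof.
move=> x p; rewrite /energyS rmorphD !rmorphM /= (rep_gradsq p) (rep_funS p).
by rewrite (rep_mk (@smooth_on_cst R n U a)).
Qed.

Lemma ev_lap_energy x (Ux : U x) (t := exist _ x Ux : points U) :
  ev t (lapS energyS) =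
  2 * (- lam * gradnorm2 x + qf (ricci g c x) (chart_grad x)
       + \tr (cometric g c x *m chart_hess t *m (cometric g c x *m chart_hess t)))
  + a * (2 * (u x * (- lam * u x) + gradnorm2 x)).
Proof.
have cE b : ev t (constS b) = b by exact: rep_mk.
have uE : ev t funS = u x by exact: rep_funS.
have e2 : ev t 2 = 2 by rewrite rmorph_nat.
rewrite /energyS lapD (lapZ dSM); last by move=> i; exact: dS_constS.
rewrite (lap_sqr dSM) (bochner dSM dSC half_constS gramS_sym cometricS_gramS) lap_funS.
rewrite rmorphD !rmorphM /= !e2 !rmorphD /= !rmorphM /= !cE !uE.
have qE : ev t (gradsqS funS) = gradnorm2 x by exact: rep_gradsq.
have d1 : ev t ((duS (constS (- lam) * funS) *m gradS funS) 0 0) = - lam * gradnorm2 x.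
  have -> : duS (constS (- lam) * funS) = constS (- lam) *: duS funS.
    by apply/rowP => k; rewrite !mxE dSM dS_constS mul0r add0r.
  by rewrite -scalemxAl mxE rmorphM /= cE -qE.
have d2 : ev t (((gradS funS)^T *m ricS *m gradS funS) 0 0)
    = qf (ricci g c x) (chart_grad x).
  have /matrixP/(_ 0 0) : map_mx (ev t) ((gradS funS)^T *m ricS *m gradS funS)
     = chart_grad x *m ricci g c x *m (chart_grad x)^T.
    by rewrite (map_mxM _ _ (gradS funS)) (map_mxM _ (gradS funS)^T) -map_trmx ev_grad trmxK ev_ric.
  by rewrite mxE.
rewrite d1 d2 qE -trace_map_mx !map_mxM ev_cometricS //.
Qed.

Section AtPoint.
Variables (x : E) (Ux : U x).
Local Notation t := (exist _ x Ux : points U).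
Hypothesis maxF : forall y, U y -> energy y <= energy x.

Lemma partial_energy k : partial k energy x =
  2 * (chart_hess t *m (chart_grad x)^T) k 0 + a * (2 * (u x * chart_du x 0 k)).
Proof.
rewrite -(rep_dS k rep_energy Ux) /energyS raddfD /= dSM dS_constS mul0r add0r dSM.
have e2 : ev t 2 = 2 by rewrite rmorph_nat.
rewrite (D_gradsq dSM half_constS gramS_sym cometricS_gramS).
rewrite rmorphD !rmorphM /= e2 rmorphD !rmorphM /=.
rewrite (rep_funS Ux) (rep_dS k rep_funS Ux) (rep_mk (@smooth_on_cst R n U a)) /cst.
have -> : ev t ((hessS funS *m gradS funS) k 0) =
    (chart_hess t *m (chart_grad x)^T) k 0.
  have /matrixP/(_ k 0) := map_mxM (ev t) (hessS funS) (gradS funS).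
  by rewrite mxE => ->; rewrite ev_grad.
rewrite [chart_du x 0 k]mxE; congr (_ + _ * _).
by rewrite [X in X + _]mulrC -mulr2n -[LHS]mulr_natl.
Qed.

Lemma smooth_energy : smooth_on U (energy : E -> R^o). Proof. exact: rep_smooth rep_energy. Qed.

(** The hypothesis on the derivative in the direction [ord0] makes the differential of
    the energy vanish at a maximum on the boundary too, so that its Laplacian is
    nonpositive. *)
Lemma max_inequality : (x 0 ord0 = 0 -> 0 <= partial ord0 energy x) ->
  lam ^+ 2 * (u x) ^+ 2 / n.+1%:R - lam * gradnorm2 x + qf (ricci g c x) (chart_grad x)
  + a * gradnorm2 x - a * lam * (u x) ^+ 2 <= 0.
Proof.
move=> bd.
have x0 : 0 <= x 0 ord0 := rel_open_half chart_rel_open Ux.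
have DF0 k : partial k energy x = 0.
  have [->|k0] := eqVneq k ord0; last first.
    by apply: (max_partial_eq0 chart_rel_open smooth_energy Ux maxF); right.
  have [xe|xn] := eqVneq (x 0 ord0) 0; last first.
    by apply: (max_partial_eq0 chart_rel_open smooth_energy Ux maxF); left; rewrite lt_def xn x0.
  apply/eqP; rewrite eq_le bd// andbT.
  exact: (max_partial_le0 chart_rel_open smooth_energy Ux maxF xe).
have lap0 : ev t (lapS energyS) <= 0.
  pose B : 'M[R]_n.+1 := \matrix_(i, j) partial j (partial i energy) x.
  have -> : ev t (lapS energyS) = \tr (cometric g c x *m B).
    rewrite /lap rmorph_sum; apply: eq_bigr => i _; rewrite rmorph_sum mxE.
    apply: eq_bigr => j _; rewrite rmorphM /= (rep_cometricS i j Ux) rmorphB rmorph_sum /=.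
    rewrite (rep_dS i (rep_dS j rep_energy) Ux) big1 ?subr0 ?[B _ _]mxE// => k _.
    by rewrite rmorphM /= (rep_dS k rep_energy Ux) DF0 mulr0.
  apply: tr_mul_le0; [exact: cometric_sym|exact: cometric_pd|move=> v].
  rewrite qfE exchange_big /=.
  have := max_hessian_le0 chart_rel_open smooth_energy Ux maxF v DF0.
  congr (_ <= 0); apply: eq_bigr => i _; apply: eq_bigr => j _.
  by rewrite [B _ _]mxE [v 0 i * _]mulrC.
rewrite ev_lap_energy in lap0.
have := trace_sqr_le (cometric_sym Ux) (cometric_pd Ux) (chart_hess_sym t).
have -> : \tr (cometric g c x *m chart_hess t) = - lam * u x.
  rewrite -(eig Ux) -(rep_lap Ux) (lapE dSC _ _ gramS_sym) -trace_map_mx map_mxM.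
  by rewrite ev_cometricS.
set T := \tr _ in lap0 *; move=> hT.
have N0 : 0 < n.+1%:R :> R by rewrite ltr0n.
have : lam ^+ 2 * u x ^+ 2 / n.+1%:R <= T.
  by rewrite ler_pdivrMr// [leRHS]mulrC; move: hT; rewrite exprMn sqrrN.
move: lap0; move: (lam ^+ 2 * u x ^+ 2 / n.+1%:R) => K; move=> lap0 hK.
rewrite -(pmulr_rle0 _ (ltr0n R 2)); apply: le_trans lap0.
rewrite -subr_ge0; set q := gradnorm2 x; set ux := u x; set rc := qf _ _.
have -> : 2 * (- lam * q + rc + T) + a * (2 * (ux * (- lam * ux) + q))
   - 2 * (K - lam * q + rc + a * q - a * lam * ux ^+ 2) = 2 * (T - K) by ring.
by rewrite mulr_ge0// subr_ge0.
Qed.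

Lemma normal_derivative_energy :
  \sum_k outward_normal g c x 0 k * partial k energy x =
  2 * (chart_grad x *m chart_hess t *m (outward_normal g c x)^T) 0 0
  + a * (2 * (u x * normal_derivative g c f x)).
Proof.
have -> : (chart_grad x *m chart_hess t *m (outward_normal g c x)^T) =
   (outward_normal g c x *m (chart_hess t *m (chart_grad x)^T)).
  by rewrite -[LHS]trmx_scalar11 !trmx_mul trmxK chart_hess_sym mulmxA.
rewrite mxE /normal_derivative !mulr_sumr -big_split; apply: eq_bigr => k _ /=.
rewrite partial_energy [chart_du x 0 k]mxE /=; ring.
Qed.

(** The tangential derivatives vanish, so the outward normal derivative is a negative
    multiple of the one in the direction [ord0]. *)
Lemma boundary_condition : x 0 ord0 = 0 ->
  \sum_k outward_normal g c x 0 k * partial k energy x <= 0 ->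
  0 <= partial ord0 energy x.
Proof.
move=> x0; rewrite (bigD1 ord0)//= big1 ?addr0; last first.
  move=> k k0; rewrite (max_partial_eq0 chart_rel_open smooth_energy Ux maxF) ?mulr0//.
  by right.
have [_ _ n0] := outward_normalP g Ac (conj Ux x0).
by rewrite nmulr_rle0.
Qed.

Lemma rep_normal_derivative :
  represents ((normalS *m (duS funS)^T) 0 0) (normal_derivative g c f).
Proof.
move=> y p; rewrite mulmx_coordE rmorph_sum; apply: eq_bigr => k _.
by rewrite rmorphM /= (rep_unit_normal _ p) !mxE (rep_dS k rep_funS p).
Qed.

Lemma partial_normal_derivative i : partial i (normal_derivative g c f) x =
  (nabla_normal g c x *m (chart_du x)^T) i 0 + (chart_hess t *m (outward_normal g c x)^T) i 0.
Proof.
rewrite -(rep_dS i rep_normal_derivative Ux) (D_normal_component dSM (constS 2^-1) gramS).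
rewrite rmorphD /=; congr (_ + _).
  have /matrixP/(_ i 0) := map_mxM (ev t) nabla_normalS (duS funS)^T.
  by rewrite mxE => ->; rewrite -map_trmx ev_du ev_nabla_unit_normal.
have /matrixP/(_ i 0) := map_mxM (ev t) (hessS funS) normalS^T.
by rewrite mxE => ->; rewrite -map_trmx ev_unit_normal.
Qed.

Hypothesis x0 : x 0 ord0 = 0.

(** The gradient of [f] is tangent to the boundary. Differentiating the Neumann
    condition along it gives Hess f (eta, grad f) = - II (grad f, grad f), and the left
    side is half the normal derivative of |grad f|^2. *)
Lemma neumann_boundary :
  (forall y, U y -> y 0 ord0 = 0 -> normal_derivative g c f y = 0) ->
  (forall X : E, X 0 ord0 = 0 -> 0 <= second_form g c x X X) ->
  0 <= partial ord0 energy x.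
Proof.
move=> nd0 cvx; apply: boundary_condition => //.
rewrite normal_derivative_energy nd0// !mulr0 addr0.
have X0 : chart_grad x 0 ord0 = 0.
  have := nd0 x Ux x0; rewrite /normal_derivative.
  under eq_bigr => k _ do rewrite !mxE -mulrA.
  rewrite -mulr_sumr => /eqP; rewrite mulf_eq0 oppr_eq0 invr_eq0.
  rewrite gt_eqF ?sqrtr_gt0 ?cometric00_gt0//= => /eqP h.
  rewrite /chart_grad mxE -[RHS]h; apply: eq_bigr => k _; rewrite [chart_du x 0 k]mxE mulrC.
  by rewrite -[in LHS](cometric_sym Ux) mxE.
have -> : (chart_grad x *m chart_hess t *m (outward_normal g c x)^T) 0 0 =
    - second_form g c x (chart_grad x) (chart_grad x).
  rewrite -mulmxA mulmx_coordE.
  have -> : second_form g c x (chart_grad x) (chart_grad x)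
      = \sum_i chart_grad x 0 i * (nabla_normal g c x *m (chart_du x)^T) i 0.
    rewrite /second_form -mulmx_coordE -(chart_grad_gram Ux) (trmx_mul (chart_grad x)) gram_sym//.
    by rewrite !mulmxA.
  rewrite -sumrN; apply: eq_bigr => i _.
  have [->|i0] := eqVneq i ord0; first by rewrite X0 !mul0r oppr0.
  rewrite -mulrN; congr (_ * _); apply/eqP; rewrite -addr_eq0 addrC.
  rewrite -partial_normal_derivative.
  by rewrite (partial_tangent chart_rel_open Ux x0 i0).
by rewrite mulrN oppr_le0 mulr_ge0// cvx.
Qed.

(** The gradient of [f] is normal to the boundary, say nu eta. On the boundary
    the Laplacian of [f] is zero; it is also Hess f (eta, eta) + nu H. So half the
    normal derivative of |grad f|^2 is nu Hess f (eta, eta) = - nu^2 H. *)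
Lemma dirichlet_boundary :
  (forall y, U y -> y 0 ord0 = 0 -> u y = 0) -> 0 <= mean_curvature g c x ->
  0 <= partial ord0 energy x.
Proof.
move=> u0 mc; apply: boundary_condition => //.
rewrite normal_derivative_energy u0// mul0r !mulr0 addr0.
have pos := cometric00_gt0 Ux; set p := cometric g c x ord0 ord0 in pos.
have spos : 0 < Num.sqrt p by rewrite sqrtr_gt0.
have pE : Num.sqrt p * Num.sqrt p = p by rewrite -expr2 sqr_sqrtr// ltW.
have du0 k y : U y -> y 0 ord0 = 0 -> k != ord0 -> partial k u y = 0.
  by move=> Uy y0 k0; exact: (partial_tangent chart_rel_open Uy y0 k0 u0).
pose v := partial ord0 u x.
have XE : chart_grad x = v *: row ord0 (cometric g c x).
  apply/rowP => j; rewrite /chart_grad mxE (bigD1 ord0)//= big1 ?addr0; last first.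
    by move=> k k0; rewrite mxE du0// mul0r.
  by rewrite !mxE.
set r := row ord0 (cometric g c x) in XE.
have eE : (chart_grad x *m chart_hess t *m (outward_normal g c x)^T) 0 0 =
    - (v / Num.sqrt p) * qf (chart_hess t) r.
  rewrite XE /outward_normal -/p -/r /qf linearZ /= -!scalemxAl -scalemxAr !mxE.
  by ring.
have := trace_split (chart_hess t) (gram_sym g Ac Ux) (cometric_sym Ux)
  (mulVmx (gram_unit Ux)) (lt0r_neq0 pos).
rewrite /= -/(induced_gram g c x) -/r chart_hess_sym.
have -> : \tr (cometric g c x *m chart_hess t) = 0.
  transitivity (- lam * u x); last by rewrite u0// mulr0.
  rewrite -(eig Ux) -(rep_lap Ux) (lapE dSC _ _ gramS_sym) -trace_map_mx map_mxM.
  by rewrite ev_cometricS.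
have -> : \matrix_(a0 < n, b < n) (chart_hess t) (lift ord0 a0) (lift ord0 b) =
   (- (v * Num.sqrt p)) *: second_form_mx g c x.
  apply/matrixP => a1 b; rewrite [LHS]mxE [RHS]mxE second_form_mxE.
  have -> : (nabla_normal g c x *m g c x) (lift ord0 a1) (lift ord0 b)
      = (Num.sqrt p)^-1 * christoffel g c ord0 (lift ord0 a1) (lift ord0 b) x.
    have /(congr1 (ev t)) :=
      nabla_unit_normal_tangent dSM half_constS gramS_sym cometricS_gramS rsqrtS (lift ord0 a1) (neq_lift0 b).
    rewrite rmorphM /= (rep_christ _ _ _ Ux) (rep_mk smooth_rsqrt_cometric) => <-.
    have /matrixP/(_ (lift ord0 a1) (lift ord0 b)) :=
      map_mxM (ev t) nabla_normalS gramS.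
    by rewrite ev_nabla_unit_normal ev_gramS => <-; rewrite mxE.
  have -> : chart_hess t (lift ord0 a1) (lift ord0 b) =
      - (christoffel g c ord0 (lift ord0 a1) (lift ord0 b) x * v).
    rewrite mxE hessE rmorphB rmorph_sum /= (rep_dS _ (rep_dS _ rep_funS) Ux).
    rewrite (bigD1 ord0)//= big1 ?addr0; last first.
      by move=> k k0; rewrite rmorphM /= (rep_dS k rep_funS Ux) du0// mulr0.
    rewrite rmorphM /= (rep_christ _ _ _ Ux) (rep_dS _ rep_funS Ux).
    rewrite (partial_tangent chart_rel_open Ux x0) ?sub0r//.
    by move=> y Uy y0; rewrite du0.
  by rewrite mulrA mulNr mulfK ?gt_eqF// mulNr mulrC.
rewrite -scalemxAl linearZ /= -/(mean_curvature g c x) -/p => trE.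
rewrite eE; set Q := qf _ _ in trE *; set m := mean_curvature _ _ _ in trE mc.
have -> : Q = p * (v * Num.sqrt p * m).
  have : p * (p^-1 * Q + - (v * Num.sqrt p) * m) = 0 by rewrite -trE mulr0.
  rewrite mulrDr mulVKf ?gt_eqF// => /eqP; rewrite addr_eq0 => /eqP ->.
  by ring.
have -> : 2 * (- (v / Num.sqrt p) * (p * (v * Num.sqrt p * m))) = - (2 * (p * v ^+ 2 * m)).
  by field; rewrite gt_eqF.
rewrite oppr_le0; apply: mulr_ge0 => //; apply: mulr_ge0 => //.
by apply: mulr_ge0; [exact: ltW | exact: sqr_ge0].
Qed.

End AtPoint.
End Fun.
End Chart.

(** * Eigenfunctions on the manifold *)

Section Global.
Context {R : realType} {n : nat} {M : topologicalType} {A : manifold R n M}.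
Local Notation E := 'rV[R]_n.+1.
Implicit Types (c d : chart R n M) (f : M -> R).

Lemma chart_invK c p : chart_dom c p -> chart_inv c (chart_map c p) = p.
Proof. by move=> cp; apply: chart_mapK; exact: mem_set. Qed.

Lemma chart_imageP c p : chart_dom c p -> chart_image c (chart_map c p).
Proof. by move=> cp; exists p. Qed.

Lemma chart_map_cvg c p : chart_dom c p -> chart_map c @ p --> chart_map c p.
Proof.
move=> cp; have := @chart_map_continuous _ _ _ c.
rewrite continuous_open_subspace; last exact: chart_dom_open.
by apply; exact: mem_set.
Qed.

Lemma chart_inv_near c p (V : set M) : chart_dom c p -> open V -> V p ->
  exists2 W : set E, open_nbhs (chart_map c p) W &
    forall y, W y -> chart_image c y -> V (chart_inv c y).
Proof.
move=> cp oV Vp.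
have /subspace_continuousP/(_ _ (chart_imageP cp)) := @chart_inv_continuous _ _ _ c.
have nV : nbhs (chart_inv c (chart_map c p)) V.
  by rewrite chart_invK//; exact: (open_nbhs_nbhs (conj oV Vp)).
move=> /(_ V nV).
rewrite /= nbhs_simpl /within /= nbhsE => -[W oW WV]; by exists W.
Qed.

(** The composite of extensions of the transition map and of [f] read in [d] extends
    [f] read in [c]. *)
Lemma chain_rule c d f p : atlas A c -> atlas A d -> smooth_function A f ->
  chart_dom c p -> chart_dom d p ->
  chart_du c f (chart_map c p) =
    chart_du d f (chart_map d p) *m (jacobian_transition c d (chart_map c p))^T.
Proof.
move=> Ac Ad sf cp dp; set x := chart_map c p; set y := chart_map d p.
have Ux : chart_image c x := chart_imageP cp.
have Uy : chart_image d y := chart_imageP dp.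
have HU := chart_rel_open c; have HV := chart_rel_open d.
have [V [G [oV Vy CG GE PG]]] := smooth_on_extension HV Uy (sf d Ad).
have U'x : (chart_map c @` (chart_dom c `&` chart_dom d)) x by exists p.
have [W [T [oW Wx CT TE]]] := atlas_smooth Ac Ad U'x.
have [W1 [oW1 W1x] W1d] := chart_inv_near cp (chart_dom_open d) dp.
have Tx : T x = y by rewrite TE// /= chart_invK.
have TE' z : W z -> W1 z -> chart_image c z ->
    T z = chart_map d (chart_inv c z) /\ chart_dom d (chart_inv c z).
  move=> Wz W1z Uz; have dz := W1d z W1z Uz; split=> //.
  case: Uz Wz dz => q cq <- Wq; rewrite chart_invK// => dq.
  by rewrite TE//; [rewrite /= chart_invK|exists q].
have dT : differentiable T x := (CT 1%N).1 x Wx.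
have dG : differentiable G y := (CG 1%N).1 y Vy.
have [W2 [oW2 W2x] W2V] : exists2 W2 : set E, open_nbhs x W2 & W2 `<=` T @^-1` V.
  have : nbhs x (T @^-1` V).
    by apply: (CT 0%N x Wx); rewrite Tx; exact: (open_nbhs_nbhs (conj oV Vy)).
  by rewrite nbhsE => -[B oB BV]; exists B.
have oWW : open (W `&` W1 `&` W2) by apply: openI => //; exact: openI.
have Jia i a : jacobian_transition c d x i a = ('D_(delta_mx 0 i) T x) 0 a.
  have dTa : differentiable (fun z => T z 0 a : R^o) x.
    by apply: (@differentiable_comp _ _ _ _ T (fun v : E => v 0 a : R^o)) => //;
      exact: differentiable_coord.
  rewrite mxE (@partial_ext _ _ _ HU x i _ _ (fun z => T z 0 a : R^o) Ux oWW _ dTa); last 2 first.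
  - by split.
  - by move=> z [[Wz W1z] W2z] Uz; rewrite (TE' z Wz W1z Uz).1.
  by rewrite derive_mx ?mxE//; exact: diff_derivable.
apply/rowP => i.
have dGT : differentiable (G \o T) x by apply: differentiable_comp => //; rewrite Tx.
rewrite !mxE (partial_ext HU i Ux oWW _ dGT) => [|//|z [[Wz W1z] W2z] Uz]; last first.
  have [Tz dz] := TE' z Wz W1z Uz.
  rewrite /= GE; [|exact: W2V|by rewrite Tz; exact: chart_imageP].
  by rewrite Tz /= chart_invK.
rewrite deriveE// diff_comp//; last by rewrite Tx.
rewrite /= -(deriveE _ dT) Tx -(deriveE _ dG) derive_sum_partial//.
apply: eq_bigr => a _; rewrite !mxE -Jia mxE mulrC; congr (_ * _).
by rewrite PG.
Qed.

Variable g : metric A.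

(** The Jacobians by which the metric and the differential transform cancel. *)
Lemma gradnorm2_chart c d f p : atlas A c -> atlas A d -> smooth_function A f ->
  chart_dom c p -> chart_dom d p ->
  gradnorm2 g c f (chart_map c p) = gradnorm2 g d f (chart_map d p).
Proof.
move=> Ac Ad sf cp dp; rewrite /gradnorm2 (chain_rule Ac Ad sf cp dp) /cometric.
have uc := gram_unit g Ac (chart_imageP cp).
have ud := gram_unit g Ad (chart_imageP dp).
have := gram_transition g Ac Ad cp dp.
set J := jacobian_transition _ _ _; set G := gram g c _ in uc *; set G' := gram g d _ in ud *.
move=> GE; have uJ : J \in unitmx.
  by move: uc; rewrite GE !unitmx_mul => /andP[/andP[]].
rewrite GE; set v := chart_du _ _ _.
have -> : invmx (J *m G' *m J^T) = (invmx J)^T *m invmx G' *m invmx J.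
  rewrite -[RHS](mulmxK (_ : J *m G' *m J^T \in unitmx)); last by rewrite -GE.
  rewrite -[LHS]mul1mx; congr (_ *m _).
  by rewrite !mulmxA mulmxKV// mulmxKV// -trmx_mul mulmxV ?trmx1.
rewrite /qf trmx_mul trmxK !mulmxA -[v *m J^T *m _]mulmxA -trmx_mul.
by rewrite mulVmx// trmx1 mulmx1 mulmxKV.
Qed.

Section Eigen.
Variable f : M -> R.
Hypothesis sf : smooth_function A f.

(** By [gradnorm2_chart] the energies read in the charts agree where the charts overlap. *)
Lemma energy_density (a : R) : exists2 phi : M -> R, continuous phi &
  forall c p, atlas A c -> chart_dom c p -> phi p = energy g c f a (chart_map c p).
Proof.
have [ch chP] : {ch : M -> chart R n M & forall p, atlas A (ch p) /\ chart_dom (ch p) p}.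
  have H p : exists c, atlas A c /\ chart_dom c p.
    by have [c Ac cp] := atlas_cover A p; exists c.
  exact: (boolp.choice H).
pose phi p := energy g (ch p) f a (chart_map (ch p) p).
have phiE c p : atlas A c -> chart_dom c p -> phi p = energy g c f a (chart_map c p).
  move=> Ac cp; have [Ad dp] := chP p; rewrite /phi /energy /= !chart_invK//.
  by rewrite (gradnorm2_chart Ad Ac sf dp cp).
exists phi => // p; have [Ac cp] := chP p; set c := ch p in Ac cp *.
have sF := smooth_energy g Ac (sf Ac) a.
have [W [G [oW Wx CG GE _]]] := smooth_on_extension (chart_rel_open c) (chart_imageP cp) sF.
have cG : G @ chart_map c p --> G (chart_map c p) := CG 0%N _ Wx.
have cmap := chart_map_cvg cp.
have cc : (G \o chart_map c) @ p --> phi p.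
  rewrite (phiE c)// -GE//; last exact: chart_imageP.
  by apply: cvg_comp cmap cG.
apply: cvg_trans cc; apply: near_eq_cvg.
have nW : \forall q \near p, W (chart_map c q) by exact: (cmap W (open_nbhs_nbhs (conj oW Wx))).
have nd : \forall q \near p, chart_dom c q.
  by apply: open_nbhs_nbhs; split=> //; exact: chart_dom_open.
apply: filterS2 nW nd => q Wq cq.
by rewrite (phiE c q Ac cq) /= GE//; exact: chart_imageP.
Qed.

(** The mean value theorem applies along segments, since chart images are locally
    convex. *)
Lemma locally_constant c p : atlas A c -> chart_dom c p ->
  (forall x, chart_image c x -> chart_du c f x = 0) -> \forall q \near p, f q = f p.
Proof.
move=> Ac cp du0; have Ux := chart_imageP cp; set x := chart_map c p in Ux.
have [B oB UE] := chart_rel_open c.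
have [W [G [oW Wx CG GE PG]]] := smooth_on_extension (chart_rel_open c) Ux (sf Ac).
have [Bx hx] : B x /\ half_space x by move: Ux; rewrite UE.
have : nbhs x (B `&` W) by apply: filterI; apply: open_nbhs_nbhs.
move=> /nbhs_normP[e /= e0 eOW].
have cmap : chart_map c @ p --> x by exact: chart_map_cvg.
have nball : \forall q \near p, `|x - chart_map c q| < e.
  by have /cvgrPdist_lt/(_ e e0) := cmap.
have nd : \forall q \near p, chart_dom c q.
  by apply: open_nbhs_nbhs; split=> //; exact: chart_dom_open.
apply: filterS2 nball nd => q xq cq.
have Uq := chart_imageP cq; set z := chart_map c q in xq Uq.
have hz : half_space z by move: Uq; rewrite UE => -[].
have seg (s : R) : 0 <= s <= 1 -> (B `&` W) (x + s *: (z - x)) /\ half_space (x + s *: (z - x)).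
  move=> /andP[s0 s1]; split.
    apply: eOW => /=; rewrite opprD addrA subrr add0r normrN normrZ ger0_norm//.
    by rewrite distrC (le_lt_trans _ xq)// ler_piMl.
  have -> : x + s *: (z - x) = (1 - s) *: x + s *: z.
    by rewrite scalerBr scalerBl scale1r; rewrite addrA addrAC.
  rewrite /half_space /= !mxE addr_ge0// mulr_ge0// subr_ge0//.
have [|y Wy|s sh] := @MVT_line R n W G x (z - x) 1 ltr01.
- by move=> s /seg[[]].
- exact: (CG 1%N).1.
rewrite scale1r mul1r [x + _]addrC subrK.
have [[Bs Ws] hs] := seg s sh.
have Us : chart_image c (x + s *: (z - x)) by rewrite UE.
rewrite derive_sum_partial; last exact: (CG 1%N).1.
rewrite big1; last first.
  move=> i _; rewrite -(PG _ i)//; have /rowP/(_ i) := du0 _ Us.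
  by rewrite !mxE => ->; rewrite mulr0.
have [_ Wz] : (B `&` W) z by apply: eOW.
move=> /eqP; rewrite subr_eq0 !GE// /= => /eqP.
by rewrite /z /x !chart_invK.
Qed.

Lemma constant_of_critical : connected [set: M] ->
  (forall c x, atlas A c -> chart_image c x -> chart_du c f x = 0) ->
  forall p q, f p = f q.
Proof.
move=> cM du0 p q.
have loc r : \forall r' \near r, f r' = f r.
  by have [c Ac cr] := atlas_cover A r; apply: (locally_constant Ac cr) => x; exact: du0.
have oE (b : R) : open [set r | f r = b].
  by rewrite openE => r /= <-; exact: loc.
have : [set r | f r = f q] = setT.
  apply: cM; first by exists q.
    by exists [set r | f r = f q]; [exact: oE | rewrite setTI].
  exists [set r | f r = f q]; last by rewrite setTI.
  rewrite -openC openE => r /= rq; apply: filterS (loc r) => r' rr' r'q.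
  by apply: rq; rewrite -rr'.
by move=> /seteqP[_ /(_ p)]; apply.
Qed.

End Eigen.

Hypothesis Ric_gt0 : ricci_positive g.

(** All eigenvalues of the Ricci tensor are positive, so both infima are over sets that
    are bounded below; the minimum of the Rayleigh quotient is one of these
    eigenvalues ([rayleigh_min]). *)
Lemma ricci_lower_boundP c p v : atlas A c -> chart_dom c p ->
  ricci_lower_bound g * qf (g c (chart_map c p)) v <= qf (ricci g c (chart_map c p)) v.
Proof.
move=> Ac cp; have Ux := chart_imageP cp; set x := chart_map c p in Ux *.
have epos d y mu : atlas A d -> chart_image d y ->
    eigenvalue (ricci g d y *m cometric g d y) mu -> 0 < mu.
  move=> Ad Uy /eigenvalueP[w wE w0].
  have wR : w *m ricci g d y = mu *: (w *m g d y).
    by rewrite scalemxAl -wE mulmxA mulmxKV// gram_unit.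
  have := Ric_gt0 Ad Uy w0; rewrite wR -scalemxAl mxE pmulr_lgt0//.
  exact: gram_posdef.
have lb d y : atlas A d -> chart_image d y ->
    lbound [set mu | eigenvalue (ricci g d y *m cometric g d y) mu] 0.
  by move=> Ad Uy mu /= /epos => /(_ Ad Uy)/ltW.
have [m em hm] := rayleigh_min (ricci_sym g Ac Ux) (gram_sym g Ac Ux) (gram_pd g Ac Ux).
apply: (le_trans _ (hm v)); apply: ler_wpM2r.
  have [->|v0] := eqVneq v 0; first by rewrite /qf !mul0mx mxE.
  by rewrite ltW// gram_pd.
apply: (@le_trans _ _ (ricci_min g c x)).
  apply: ge_inf; last by exists c, p.
  exists 0 => _ [d [q [Ad dq ->]]]; rewrite /ricci_min.
  have Uy := chart_imageP dq.
  have [m' em' _] := rayleigh_min (ricci_sym g Ad Uy) (gram_sym g Ad Uy) (gram_pd g Ad Uy).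
  apply: lb_le_inf; first by exists m'.
  exact: lb.
by apply: ge_inf => //; exists 0; exact: lb.
Qed.

Section Eigenvalue.
Hypothesis Mcompact : compact [set: M].
Variables (f : M -> R) (lam : R).
Hypothesis ef : eigenfunction g lam f.
Hypothesis lam_le : lam <= ricci_lower_bound g.
Hypothesis normal_ge0 : forall c x a, atlas A c -> chart_image c x -> x 0 ord0 = 0 ->
  (forall y, chart_image c y -> energy g c f a y <= energy g c f a x) ->
  0 <= partial ord0 (energy g c f a) x.

Lemma eigen_chart c x : atlas A c -> chart_image c x ->
  laplacian g c f x = - lam * (f \o chart_inv c) x.
Proof.
by case: ef => _ _ eq Ac [p cp <-]; rewrite eq//= chart_invK.
Qed.

Lemma gradnorm2_ge0 c x : atlas A c -> chart_image c x -> 0 <= gradnorm2 g c f x.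
Proof.
move=> Ac Ux; rewrite /gradnorm2; have [->|v0] := eqVneq (chart_du c f x) 0.
  by rewrite /qf !mul0mx mxE.
by rewrite ltW// cometric_pd.
Qed.

Lemma gradnorm2_eq0 c x : atlas A c -> chart_image c x -> gradnorm2 g c f x <= 0 ->
  chart_du c f x = 0.
Proof.
move=> Ac Ux q0; apply/eqP; apply: contraTT q0 => v0.
by rewrite -ltNge /gradnorm2 cometric_pd.
Qed.

Lemma energy_max (a : R) : exists c p, [/\ atlas A c, chart_dom c p,
  forall d q, atlas A d -> chart_dom d q ->
    energy g d f a (chart_map d q) <= energy g c f a (chart_map c p) &
  lam ^+ 2 * f p ^+ 2 / n.+1%:R - lam * gradnorm2 g c f (chart_map c p)
  + qf (ricci g c (chart_map c p)) (chart_grad g c f (chart_map c p))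
  + a * gradnorm2 g c f (chart_map c p) - a * lam * f p ^+ 2 <= 0].
Proof.
have [sf [p1 _] _] := ef.
have [phi cphi phiE] := energy_density sf a.
have [||p _ pmax] := compact_EVT_max _ Mcompact (f := phi).
- by exists p1.
- exact: continuous_subspaceT.
have [c Ac cp] := atlas_cover A p; have Ux := chart_imageP cp.
have maxF d q : atlas A d -> chart_dom d q ->
    energy g d f a (chart_map d q) <= energy g c f a (chart_map c p).
  by move=> Ad dq; rewrite -!phiE//; apply: pmax; exact: mem_set.
have maxc y : chart_image c y -> energy g c f a y <= energy g c f a (chart_map c p).
  by move=> [q cq <-]; exact: maxF.
exists c, p; split=> //.
have := max_inequality Ac (sf c Ac) (fun x => eigen_chart Ac (x := x)) Ux maxc.
rewrite /= chart_invK//; apply => x0.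
exact: normal_ge0.
Qed.

(** Bound the Ricci term of [energy_max] below by [lam] times the squared gradient. The
    weight [a] makes the remaining coefficients of [f p ^+ 2] and of the squared gradient
    positive. So the energy vanishes at its maximum, and [f] is zero
    everywhere, which an eigenfunction is not. *)
Lemma eigenvalue_eq0 : lam = 0.
Proof.
apply/eqP/negPn/negP => l0; have [_ [p1 fp1] _] := ef.
have N0 : 0 < n.+1%:R :> R by rewrite ltr0n.
pose a := `|lam| / (2 * n.+1%:R).
have a0 : 0 < a by rewrite divr_gt0 ?normr_gt0// mulr_gt0.
have [c [p [Ac cp maxF ineq]]] := energy_max a.
have Ux := chart_imageP cp.
have q0 := gradnorm2_ge0 Ac Ux.
have := ricci_lower_boundP (chart_grad g c f (chart_map c p)) Ac cp.
rewrite -(gradnorm2_grad g Ac)//.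
move: ineq; set q := gradnorm2 _ _ _ _ in q0 *; set rc := qf _ _ => ineq hrc.
have hq : lam * q <= rc by apply: le_trans hrc; exact: ler_wpM2r.
have al : a * lam <= lam ^+ 2 / (2 * n.+1%:R).
  rewrite /a mulrAC ler_pM2r ?invr_gt0 ?mulr_gt0//.
  by rewrite -[leRHS]ger0_norm ?sqr_ge0// normrX expr2 ler_wpM2l// ler_norm.
set K := lam ^+ 2 / (2 * n.+1%:R) in al.
have K0 : 0 < K by apply: divr_gt0; [rewrite exprn_even_gt0 | rewrite mulr_gt0].
have KE : lam ^+ 2 * f p ^+ 2 / n.+1%:R = 2 * K * f p ^+ 2.
  by rewrite /K; field; rewrite gt_eqF.
rewrite KE in ineq.
have f2 : 0 <= f p ^+ 2 := sqr_ge0 _.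
have h1 : a * lam * f p ^+ 2 <= K * f p ^+ 2 by apply: ler_wpM2r.
have h2 : 0 <= K * f p ^+ 2 by apply: mulr_ge0 => //; exact: ltW.
have h3 : 0 <= a * q by apply: mulr_ge0 => //; exact: ltW.
have h4 : K * f p ^+ 2 + a * q <= 0.
  have E1 : 2 * K * f p ^+ 2 - lam * q + rc + a * q - a * lam * f p ^+ 2
     = (K * f p ^+ 2 + a * q) + (rc - lam * q) + (K * f p ^+ 2 - a * lam * f p ^+ 2) by ring.
  rewrite E1 in ineq; apply: le_trans ineq; rewrite -addrA lerDl.
  by apply: addr_ge0; rewrite subr_ge0.
have Kf0 : K * f p ^+ 2 = 0.
  by apply/eqP; rewrite eq_le h2 andbT; apply: le_trans h4; rewrite lerDl.
have aq0 : a * q = 0.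
  by apply/eqP; rewrite eq_le h3 andbT; apply: le_trans h4; rewrite lerDr.
have fp0 : f p = 0.
  by move/eqP: Kf0; rewrite mulf_eq0 (gt_eqF K0) sqrf_eq0 => /eqP.
have [d Ad dp] := atlas_cover A p1.
have := maxF d p1 Ad dp; rewrite /energy /= !chart_invK// -/q fp0 mul0r mulr0 addr0.
have -> : q = 0 by move/eqP: aq0; rewrite mulf_eq0 (gt_eqF a0) => /eqP.
rewrite leNgt => /negP; apply; apply: ltr_wpDl.
  exact: gradnorm2_ge0 (chart_imageP dp).
by apply: mulr_gt0 => //; rewrite -expr2 exprn_even_gt0.
Qed.

(** For [a = 0] the inequality in [energy_max] says that the Ricci form is nonpositive on
    the gradient at the point where the gradient is largest. *)
Lemma zero_eigenvalue_critical : lam = 0 ->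
  forall c x, atlas A c -> chart_image c x -> chart_du c f x = 0.
Proof.
move=> l0; have [c [p [Ac cp maxF]]] := energy_max 0.
have Ux := chart_imageP cp.
rewrite l0 expr0n /= !(mul0r, subr0, oppr0, add0r, addr0) => ric_le0.
have X0 : chart_grad g c f (chart_map c p) = 0.
  apply/eqP; apply: contraTT ric_le0 => X0; rewrite -ltNge.
  exact: (Ric_gt0 Ac Ux X0).
have q0 : gradnorm2 g c f (chart_map c p) = 0.
  by rewrite gradnorm2_grad// X0 /qf !mul0mx mxE.
move=> d y Ad Uy; apply: gradnorm2_eq0 => //; case: Uy => q dq <-.
by have := maxF d q Ad dq; rewrite /energy !mul0r !addr0 q0.
Qed.

End Eigenvalue.
End Global.

Theorem corollary1p1 (R : realType) (n : nat) (M : topologicalType)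
    (A : manifold R n M) (g : metric A)
    (Mcompact : compact [set: M]) (Mconnected : connected [set: M])
    (Mboundary : manifold_boundary A !=set0) (Ric_gt0 : ricci_positive g) :
  (mean_convex_boundary g ->
     forall lambda1D : R, first_dirichlet_eigenvalue g lambda1D ->
       ricci_lower_bound g < lambda1D) /\
  (convex_boundary g ->
     forall lambda1N : R, first_neumann_eigenvalue g lambda1N ->
       ricci_lower_bound g < lambda1N).
Proof.
split=> cvx lam.
- move=> [[f ef f0] _]; rewrite ltNge; apply/negP => lam_le.
  have [sf [p1 fp1] _] := ef.
  have bd c x a : atlas A c -> chart_image c x -> x 0 ord0 = 0 ->
      (forall y, chart_image c y -> energy g c f a y <= energy g c f a x) ->
      0 <= partial ord0 (energy g c f a) x.
    move=> Ac Ux x0 maxF.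
    apply: (dirichlet_boundary Ac (sf c Ac) (fun y Uy => eigen_chart ef Ac Uy) Ux maxF x0).
      move=> y [q cq <-] y0 /=; rewrite chart_invK//; apply: f0.
      by exists c.
    exact: cvx.
  have l0 := eigenvalue_eq0 Ric_gt0 Mcompact ef lam_le bd.
  have crit := zero_eigenvalue_critical Ric_gt0 Mcompact ef bd l0.
  have [p0 bp0] := Mboundary.
  move/eqP: fp1; apply.
  by rewrite (constant_of_critical sf Mconnected crit p1 p0) f0.
- move=> [[f ef f0] l0 _]; rewrite ltNge; apply/negP => lam_le.
  have [sf _ _] := ef.
  suff e0 : lam = 0 by move: l0; rewrite e0 ltxx.
  apply: (eigenvalue_eq0 Ric_gt0 Mcompact ef lam_le) => c x a Ac Ux x0 maxF.
  apply: (neumann_boundary Ac (sf c Ac) Ux maxF x0).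
    by move=> y Uy y0; exact: f0.
  by move=> X X0; exact: cvx.
Qed.
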